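(* Let $\lambda,\mu\in\mathbb{C}$ with $\mu-\lambda\notin\{0,\tfrac12,1,\tfrac32,2\}$. Then: (i) The space $\mathcal{D}^{2}_{\lambda\mu}$ of $2$-differential operators from $\mathcal{F}_\lambda$ to $\mathcal{F}_\mu$ and the corresponding space of symbols $\operatorname{gr}\mathcal{D}^2_{\lambda\mu}=\bigoplus_{i=0}^{4}\operatorname{gr}^{i/2}\mathcal{D}_{\lambda\mu}$ are isomorphic as $\mathrm{osp}(2|2)$-modules. (ii) This isomorphism is unique: there is exactly one $\mathrm{osp}(2|2)$-equivariant quantization map $Q:\operatorname{gr}\mathcal{D}^2_{\lambda\mu}\to\mathcal{D}^2_{\lambda\mu}$.
   Context: Functions on the supercircle $S^{1|2}$: $C^\infty(S^{1|2})$ consists of $f=f_0(x)+\xi_1f_1(x)+\xi_2f_2(x)+\xi_1\xi_2f_{12}(x)$ with $f_0,f_1,f_2,f_{12}$ smooth complex-valued functions on the circle and $\xi_1,\xi_2$ odd Grassmann variables ($\xi_i^2=0$, $\xi_1\xi_2=-\xi_2\xi_1$); parity $p(x)=0$, $p(\xi_i)=1$; $f'=\partial_x f$. Set $\overline{D}_i=\partial_{\xi_i}-\xi_i\partial_x$ ($i=1,2$), so $\overline D_i^2=-\partial_x$. For homogeneous $f$ the contact vector field is $X_f=f\partial_x-(-1)^{p(f)}\tfrac12\big(\overline D_1(f)\overline D_1+\overline D_2(f)\overline D_2\big)$; these form the Lie superalgebra $\mathcal K(2)$. The subalgebra $\mathrm{osp}(2|2)\subset\mathcal K(2)$ is spanned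 by $X_f$ for $f\in\{1,x,x^2,\xi_1\xi_2,\xi_1,\xi_2,x\xi_1,x\xi_2\}$. For $\lambda\in\mathbb C$, $\mathcal F_\lambda$ denotes $C^\infty(S^{1|2})$ with $\mathcal K(2)$-action $L^\lambda_{X_f}=X_f+\lambda f'$ ($f'$ acting by multiplication). $\mathcal D_{\lambda\mu}$ is the space of linear differential operators $\mathcal F_\lambda\to\mathcal F_\mu$, with $\mathcal K(2)$-action $\mathcal L_{X_f}(A)=L^\mu_{X_f}\circ A-(-1)^{p(f)p(A)}A\circ L^\lambda_{X_f}$. Every $A\in\mathcal D_{\lambda\mu}$ is a finite sum $\sum a_{\ell,m,n}\partial_x^\ell\overline D_1^m\overline D_2^n$ with $a_{\ell,m,n}\in C^\infty(S^{1|2})$, $\ell\ge0$, $m,n\in\{0,1\}$. For $k\in\frac12\mathbb Z_{\ge0}$, $\mathcal D^k_{\lambda\mu}$ is the subspace of those $A$ with $a_{\ell,m,n}=0$ unless $\ell+\frac m2+\frac n2\le k$ (a $\mathcal K(2)$-invariant filtration); $\operatorname{gr}^k\mathcal D_{\lambda\mu}=\mathcal D^k_{\lambda\mu}/\mathcal D^{k-1/2}_{\lambda\mu}$ (with $\mathcal D^{-1/2}=0$), with the induced $\mathcal K(2)$-action, and the principal symbol $\sigma_{pr}:\mathcal D^k_{\lambda\mu}\to\operatorname{gr}^k\mathcal D_{\lambda\mu}$ is the projection. A quantization map $Q:\operatorname{gr}\mathcal D^2_{\lambda\mu}\to\mathcal D^2_{\lambda\mu}$ is a linear bijection (given by differential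 expressions) such that for each $k$ it maps $\operatorname{gr}^k$ into $\mathcal D^k_{\lambda\mu}$ with $\sigma_{pr}\circ Q=\mathrm{id}$ on $\operatorname{gr}^k$.
   Formalization: Functions are taken smooth in a global coordinate x on the line (superspace R^{1|2}) instead of on the circle, because x and x^2 are not functions on the circle, so the osp(2|2)-action by X_x, X_{x^2}, X_{xξ_i} is not defined on functions on S^{1|2}. *)

(* Defs.v *)
From HB Require Import structures.
From mathcomp Require Import all_boot all_order all_algebra.
From mathcomp Require Import all_classical all_reals all_analysis.
From mathcomp Require Import complex.
Set Implicit Arguments. Unset Strict Implicit. Unset Printing Implicit Defensive.
Import Order.TTheory GRing.Theory Num.Theory.
Local Open Scope ring_scope.

Definition cder (R : realType) (f : R -> R[i]) : R -> R[i] :=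
  fun x => Complex (derive1 (fun t => complex.Re (f t)) x)
                   (derive1 (fun t => complex.Im (f t)) x).

Definition csmooth (R : realType) (f : R -> R[i]) : Prop :=
  forall (n : nat) (x : R),
    derivable (fun t => complex.Re (iter n (@cder R) f t)) x 1 /\
    derivable (fun t => complex.Im (iter n (@cder R) f t)) x 1.

(* Superfunctions  f = f0 + xi1 f1 + xi2 f2 + xi1 xi2 f12                     *)

Record sfun (R : realType) := SFun {
  s0 : R -> R[i]; s1 : R -> R[i]; s2 : R -> R[i]; s12 : R -> R[i] }.
Arguments SFun {R}.

Definition ssmooth (R : realType) (f : sfun R) : Prop :=
  csmooth (s0 f) /\ csmooth (s1 f) /\ csmooth (s2 f) /\ csmooth (s12 f).

Definition szero (R : realType) : sfun R :=
  SFun (fun _ => 0) (fun _ => 0) (fun _ => 0) (fun _ => 0).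

Definition sadd (R : realType) (f g : sfun R) : sfun R :=
  SFun (fun x => s0 f x + s0 g x) (fun x => s1 f x + s1 g x)
       (fun x => s2 f x + s2 g x) (fun x => s12 f x + s12 g x).

Definition sopp (R : realType) (f : sfun R) : sfun R :=
  SFun (fun x => - s0 f x) (fun x => - s1 f x)
       (fun x => - s2 f x) (fun x => - s12 f x).

Definition sscale (R : realType) (c : R[i]) (f : sfun R) : sfun R :=
  SFun (fun x => c * s0 f x) (fun x => c * s1 f x)
       (fun x => c * s2 f x) (fun x => c * s12 f x).

(* product in C^infty(S^{1|2}) (Grassmann rules xi_i^2 = 0,
   xi1 xi2 = - xi2 xi1) *)
Definition smul (R : realType) (f g : sfun R) : sfun R :=
  SFun (fun x => s0 f x * s0 g x)
       (fun x => s0 f x * s1 g x + s1 f x * s0 g x)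
       (fun x => s0 f x * s2 g x + s2 f x * s0 g x)
       (fun x => s0 f x * s12 g x + s12 f x * s0 g x
                 + s1 f x * s2 g x - s2 f x * s1 g x).

Definition sdx (R : realType) (f : sfun R) : sfun R :=
  SFun (cder (s0 f)) (cder (s1 f)) (cder (s2 f)) (cder (s12 f)).

(* partial_{xi_i} (left derivatives) *)
Definition sdxi1 (R : realType) (f : sfun R) : sfun R :=
  SFun (s1 f) (fun _ => 0) (s12 f) (fun _ => 0).
Definition sdxi2 (R : realType) (f : sfun R) : sfun R :=
  SFun (s2 f) (fun x => - s12 f x) (fun _ => 0) (fun _ => 0).

Definition sxi1 (R : realType) (f : sfun R) : sfun R :=
  SFun (fun _ => 0) (s0 f) (fun _ => 0) (s2 f).
Definition sxi2 (R : realType) (f : sfun R) : sfun R :=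
  SFun (fun _ => 0) (fun _ => 0) (s0 f) (fun x => - s1 f x).

Definition sD1 (R : realType) (f : sfun R) : sfun R :=
  sadd (sdxi1 f) (sopp (sxi1 (sdx f))).
Definition sD2 (R : realType) (f : sfun R) : sfun R :=
  sadd (sdxi2 f) (sopp (sxi2 (sdx f))).

Definition sev (R : realType) (f : sfun R) : sfun R :=
  SFun (s0 f) (fun _ => 0) (fun _ => 0) (s12 f).
Definition sod (R : realType) (f : sfun R) : sfun R :=
  SFun (fun _ => 0) (s1 f) (s2 f) (fun _ => 0).

Definition sbig (R : realType) (I : Type) (r : seq I) (F : I -> sfun R) :=
  \big[@sadd R/@szero R]_(i <- r) F i.

(* X_f g for homogeneous f of parity pf :
   X_f = f dx - (-1)^{p(f)} 1/2 (Dbar1(f) Dbar1 + Dbar2(f) Dbar2) *)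
Definition Xcontact (R : realType) (f : sfun R) (pf : bool) (g : sfun R) :=
  sadd (smul f (sdx g))
       (sscale (- ((-1) ^+ pf) / 2)
               (sadd (smul (sD1 f) (sD1 g)) (smul (sD2 f) (sD2 g)))).

Definition Lact (R : realType) (lam : R[i]) (f : sfun R) (pf : bool)
  (g : sfun R) : sfun R :=
  sadd (Xcontact f pf g) (sscale lam (smul (sdx f) g)).

Inductive ospgen := G1 | Gx | Gx2 | Gxi12 | Gxi1 | Gxi2 | Gxxi1 | Gxxi2.

Definition cst (R : realType) (c : R[i]) : R -> R[i] := fun _ => c.
Definition xC (R : realType) : R -> R[i] := fun x => Complex x 0.

Definition gen_fun (R : realType) (X : ospgen) : sfun R :=
  match X with
  | G1    => SFun (cst 1) (cst 0) (cst 0) (cst 0)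
  | Gx    => SFun (@xC R) (cst 0) (cst 0) (cst 0)
  | Gx2   => SFun (fun x => xC x * xC x) (cst 0) (cst 0) (cst 0)
  | Gxi12 => SFun (cst 0) (cst 0) (cst 0) (cst 1)
  | Gxi1  => SFun (cst 0) (cst 1) (cst 0) (cst 0)
  | Gxi2  => SFun (cst 0) (cst 0) (cst 1) (cst 0)
  | Gxxi1 => SFun (cst 0) (@xC R) (cst 0) (cst 0)
  | Gxxi2 => SFun (cst 0) (cst 0) (@xC R) (cst 0)
  end.

Definition gen_odd (X : ospgen) : bool :=
  match X with
  | G1 | Gx | Gx2 | Gxi12 => false
  | Gxi1 | Gxi2 | Gxxi1 | Gxxi2 => true
  end.

Definition Lgen (R : realType) (lam : R[i]) (X : ospgen) : sfun R -> sfun R :=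
  Lact lam (gen_fun R X) (gen_odd X).

Definition op (R : realType) := sfun R -> sfun R.

Definition op_ev (R : realType) (A : op R) : op R :=
  fun g => sadd (sev (A (sev g))) (sod (A (sod g))).
Definition op_od (R : realType) (A : op R) : op R :=
  fun g => sadd (sod (A (sev g))) (sev (A (sod g))).

(* cal L_{X_f}(A) = L^mu_{X_f} o A - (-1)^{p(f) p(A)} A o L^lambda_{X_f},
   extended linearly in A *)
Definition Lop (R : realType) (lam mu : R[i]) (X : ospgen) (A : op R) : op R :=
  fun g =>
    if gen_odd X then
      sadd (Lgen mu X (A g))
           (sopp (sadd (op_ev A (Lgen lam X g))
                       (sopp (op_od A (Lgen lam X g)))))
    else sadd (Lgen mu X (A g)) (sopp (A (Lgen lam X g))).

Definition mono (R : realType) (l : nat) (m n : bool) (g : sfun R) : sfun R :=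
  iter l (@sdx R) ((if m then @sD1 R else id) ((if n then @sD2 R else id) g)).

Definition bools : seq bool := [:: false; true].

(* twice the weight l + m/2 + n/2 *)
Definition wt (l : nat) (m n : bool) : nat := (2 * l + m + n)%N.

Definition Dsum (R : realType) (N : nat) (P : nat -> bool -> bool -> bool)
  (A : op R) : Prop :=
  exists a : nat -> bool -> bool -> sfun R,
    (forall l m n, ssmooth (a l m n)) /\
    forall g, ssmooth g ->
      A g = sbig (iota 0 N) (fun l => sbig bools (fun m => sbig bools (fun n =>
              if P l m n then smul (a l m n) (mono l m n g) else szero R))).

(* D^k with K = 2k : operators with 2l + m + n <= K *)
Definition Dle (R : realType) (K : nat) (A : op R) : Prop :=
  Dsum K.+1 (fun l m n => (wt l m n <= K)%N) A.
(* D^{k - 1/2} with K = 2k : operators with 2l + m + n < K (zero if K = 0) *)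
Definition Dlt (R : realType) (K : nat) (A : op R) : Prop :=
  Dsum K.+1 (fun l m n => (wt l m n < K)%N) A.
Definition isdiffop (R : realType) (A : op R) : Prop := exists K, Dle K A.

Definition opsub (R : realType) (A B : op R) : op R :=
  fun g => sadd (A g) (sopp (B g)).

(* gr^k D_{lambda mu} (K = 2k) is identified, via the monomial basis, with
   families (s m n) of superfunctions indexed by the (m, n) such that
   2l + m + n = K for some l >= 0, i.e. m + n <= K and m + n = K mod 2;
   s m n is the coefficient of dx^l Dbar1^m Dbar2^n. *)
Definition valid (K : nat) (m n : bool) : bool :=
  ((m + n <= K)%N && (odd (m + n) == odd K)).
Definition lvl (K : nat) (m n : bool) : nat := ((K - (m + n)) %/ 2)%N.

Definition sym (R : realType) (K : nat) (s : bool -> bool -> sfun R) : Prop :=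
  forall m n, if valid K m n then ssmooth (s m n) else s m n = szero R.

(* the homogeneous operator sum_{2l+m+n=K} s_{m,n} dx^l Dbar1^m Dbar2^n
   (representative of the class of s in D^k / D^{k-1/2}) *)
Definition opsym (R : realType) (K : nat) (s : bool -> bool -> sfun R) : op R :=
  fun g => sbig bools (fun m => sbig bools (fun n =>
    if valid K m n then smul (s m n) (mono (lvl K m n) m n g) else szero R)).

(* elements of gr D^2 = (+)_{K=0..4} gr^{K/2} *)
Definition grT (R : realType) := nat -> bool -> bool -> sfun R.

Definition graded (R : realType) (sg : grT R) : Prop :=
  forall K, if (K < 5)%N then sym K (sg K) else forall m n, sg K m n = szero R.

Definition gadd (R : realType) (sg tg : grT R) : grT R :=
  fun K m n => sadd (sg K m n) (tg K m n).
Definition gscale (R : realType) (c : R[i]) (sg : grT R) : grT R :=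
  fun K m n => sscale c (sg K m n).

Definition grinj (R : realType) (K : nat) (s : bool -> bool -> sfun R) : grT R :=
  fun K' => if K' == K then s else fun _ _ => szero R.

(* induced action of X on gr D^2:  grrel X sg sg' means sg' = L_X(sg),
   i.e. for each K, L_X(opsym K (sg K)) - opsym K (sg' K) lies in D^{K/2-1/2} *)
Definition grrel (R : realType) (lam mu : R[i]) (X : ospgen) (sg sg' : grT R)
  : Prop :=
  graded sg' /\
  forall K, (K < 5)%N ->
    Dlt K (opsub (Lop lam mu X (opsym K (sg K))) (opsym K (sg' K))).

Definition Map (R : realType) := grT R -> op R.

Definition opeq (R : realType) (A B : op R) : Prop :=
  forall g, ssmooth g -> A g = B g.

Definition linear_map (R : realType) (Q : Map R) : Prop :=
  forall (sg tg : grT R) (c d : R[i]), graded sg -> graded tg ->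
    opeq (Q (gadd (gscale c sg) (gscale d tg)))
         (fun g => sadd (sscale c (Q sg g)) (sscale d (Q tg g))).

Definition bijective_map (R : realType) (Q : Map R) : Prop :=
  (forall sg, graded sg -> Dle 4 (Q sg)) /\
  (forall sg tg, graded sg -> graded tg -> opeq (Q sg) (Q tg) -> sg = tg) /\
  (forall A, Dle 4 A -> exists sg, graded sg /\ opeq (Q sg) A).

(* osp(2|2)-equivariance (with respect to the basis, hence to all of
   osp(2|2) by linearity) *)
Definition equivariant (R : realType) (lam mu : R[i]) (Q : Map R) : Prop :=
  forall X sg sg', graded sg -> grrel lam mu X sg sg' ->
    opeq (Q sg') (Lop lam mu X (Q sg)).

(* Q is given by differential expressions: on each summand gr^{K/2} the
   coefficients of Q(s) are obtained by applying differential operators to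
   the coefficients of s *)
Definition diffexpr (R : realType) (Q : Map R) : Prop :=
  forall K, (K < 5)%N ->
  exists T : bool -> bool -> nat -> bool -> bool -> op R,
    (forall m n l' m' n', isdiffop (T m n l' m' n')) /\
    forall s, sym K s ->
      opeq (Q (grinj K s))
        (fun g => sbig (iota 0 K.+1) (fun l' => sbig bools (fun m' =>
           sbig bools (fun n' =>
             if (wt l' m' n' <= K)%N then
               smul (sbig bools (fun m => sbig bools (fun n =>
                        if valid K m n then T m n l' m' n' (s m n)
                        else szero R)))
                    (mono l' m' n' g)
             else szero R)))).

Definition quantization (R : realType) (Q : Map R) : Prop :=
  linear_map Q /\ bijective_map Q /\ diffexpr Q /\
  forall K s, (K < 5)%N -> sym K s ->
    Dle K (Q (grinj K s)) /\ Dlt K (opsub (Q (grinj K s)) (opsym K s)).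

Definition osp_iso (R : realType) (lam mu : R[i]) (Phi : Map R) : Prop :=
  linear_map Phi /\ bijective_map Phi /\ equivariant lam mu Phi.

(* Main.v *)
Require Import Defs.
From HB Require Import structures.
From mathcomp Require Import all_boot all_order all_algebra ring.
Set Implicit Arguments. Unset Strict Implicit. Unset Printing Implicit Defensive.
Import Order.TTheory GRing.Theory Num.Theory.
Local Open Scope ring_scope.

(* Write [del = mu - lam].  In the coefficients of [dx^l Dbar1^m Dbar2^n] the action
   of X_F is block triangular: its diagonal part on gr^k is the density action of
   weight h = del - k, twisted on the pair (Dbar1, Dbar2) by the rotation
   D1 D2 (F) / 2, and the lower order part multiplies by F'' and Dbar_i(F').

   Existence: an explicit unitriangular map, with constant coefficients in the
   derivatives dx^l Dbar1^m Dbar2^n of the symbols, has only the denominators del,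
   del - 1, del - 2, 2 del - 1, 2 del - 3 and commutes with the action.

   Uniqueness: two equivariant quantizations differ by a unitriangular automorphism
   of gr commuting with osp(2|2), hence with the Casimir elements.  The quadratic
   one is h^2 on integral levels.  The cubic one vanishes on integral levels and its
   square is a nonzero scalar, different for k = 1/2 and k = 3/2, on half-integral
   ones.  These values are pairwise distinct, so the automorphism preserves the
   grading and is the identity.  (The quadratic Casimir alone does not suffice: for
   del = 2/3 it takes the same value on k = 3/2 and k = 0.) *)
(* The algebra is done over an abstract differential algebra of functions and before
   analysis is loaded: this keeps ring normalisation fast, and the module protects
   its names from the later imports. *)
Module Super.

(** By [dev_inj] an element is determined by its values, so every identity between superfunctions
    reduces to field identities at a point. *)
Record dalg (F : numFieldType) := DAlg {
  dpt : Type;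
  dcar :> Type;
  dev : dcar -> dpt -> F;
  dadd : dcar -> dcar -> dcar;
  dmul : dcar -> dcar -> dcar;
  dopp : dcar -> dcar;
  dcst : F -> dcar;
  dder : dcar -> dcar;
  dvar : dcar;
  dev_inj : forall u v, dev u =1 dev v -> u = v;
  devD : forall u v x, dev (dadd u v) x = dev u x + dev v x;
  devM : forall u v x, dev (dmul u v) x = dev u x * dev v x;
  devN : forall u x, dev (dopp u) x = - dev u x;
  devC : forall k x, dev (dcst k) x = k;
  dderD : forall u v, dder (dadd u v) = dadd (dder u) (dder v);
  dderM : forall u v, dder (dmul u v) = dadd (dmul (dder u) v) (dmul u (dder v));
  dderN : forall u, dder (dopp u) = dopp (dder u);
  dderC : forall k, dder (dcst k) = dcst 0;
  dder_var : dder dvar = dcst 1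
}.

(** * Differential algebras and their jets *)

Section Jets.
Variables (F : numFieldType) (A : dalg F) (x : dpt A).
Implicit Types (u v : A) (i j : nat -> F).

(* [j] lists the values at [x] of the successive derivatives of [u]; instance
   resolution computes it by the Leibniz rule. *)
Class jet u j := jetP : forall n, dev (iter n (@dder F A) u) x = j n.

(** Recursion on (uv)' = u'v + uv' rather than binomial coefficients: for a numeral [n] it computes
    to an explicit polynomial in the jets. *)
Fixpoint leibniz n i j : F :=
  if n is m.+1 then leibniz m (fun k => i k.+1) j + leibniz m i (fun k => j k.+1)
  else i 0%N * j 0%N.

Lemma iter_dderD n u v :
  iter n (@dder F A) (dadd u v) = dadd (iter n (@dder F A) u) (iter n (@dder F A) v).
Proof. by elim: n u v => [|n IH] u v; rewrite ?iterSr ?dderD ?IH -?iterSr. Qed.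

Global Instance jetD u v i j : jet u i -> jet v j ->
  jet (dadd u v) (fun n => i n + j n).
Proof. by move=> hu hv n; rewrite -hu -hv iter_dderD devD. Qed.

Global Instance jet_der u i : jet u i -> jet (dder u) (fun n => i n.+1).
Proof. by move=> hu n; rewrite -iterSr hu. Qed.

Global Instance jetM u v i j : jet u i -> jet v j ->
  jet (dmul u v) (fun n => leibniz n i j).
Proof.
move=> + + n; elim: n u v i j => [|n IH] u v i j hu hv.
  by rewrite /= devM (hu 0%N : dev u x = _) (hv 0%N : dev v x = _).
rewrite iterSr dderM iter_dderD devD.
by rewrite (IH _ _ _ _ (jet_der hu) hv) (IH _ _ _ _ hu (jet_der hv)).
Qed.

Global Instance jetN u i : jet u i -> jet (dopp u) (fun n => - i n).
Proof.
move=> hu n; rewrite -hu.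
by elim: n u {hu} => [|n IH] u; rewrite ?iterSr ?dderN ?IH -?iterSr// devN.
Qed.

Global Instance jetC k : jet (dcst A k) (fun n => if n is 0 then k else 0).
Proof.
move=> n; elim: n k => [|n IH] k; first by rewrite /= devC.
by rewrite iterSr dderC IH; case: n {IH}.
Qed.

Global Instance jetX : jet (dvar A)
  (fun n => match n with 0 => dev (dvar A) x | 1 => 1 | _ => 0 end).
Proof. by move=> [|n]//; rewrite iterSr dder_var jetC; case: n. Qed.

(** Fallback of low priority: only what no structural instance decomposes is left as an atom with
    unknown derivatives. *)
Global Instance jet_atom u : jet u (fun n => dev (iter n (@dder F A) u) x) | 10.
Proof. by []. Qed.

Lemma jet_eq u v i j : jet u i -> jet v j -> i 0%N = j 0%N -> dev u x = dev v x.
Proof. by move=> /(_ 0%N) /= -> /(_ 0%N) /= ->. Qed.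

End Jets.

(** * Superfunctions and operator coefficients over a differential algebra *)

Section Super.
Variables (F : numFieldType) (A : dalg F).
Implicit Types (k h : F).

Record ssf := Ssf { a0 : A; a1 : A; a2 : A; a3 : A }.
Implicit Types a b c g t p q u : ssf.

Lemma ssf_ext a b : (forall x, dev (a0 a) x = dev (a0 b) x) ->
  (forall x, dev (a1 a) x = dev (a1 b) x) -> (forall x, dev (a2 a) x = dev (a2 b) x) ->
  (forall x, dev (a3 a) x = dev (a3 b) x) -> a = b.
Proof.
by case: a b => [? ? ? ?] [? ? ? ?] /= /dev_inj-> /dev_inj-> /dev_inj-> /dev_inj->.
Qed.

Local Notation "u +' v" := (dadd u v) (at level 50, left associativity).
Local Notation "u *' v" := (dmul u v) (at level 40, left associativity).
Local Notation "-' u" := (dopp u) (at level 35, right associativity).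
Local Notation "k *:' u" := (dmul (dcst _ k) u) (at level 40).
Local Notation "\d u" := (dder u) (at level 10, u at level 9).
Local Notation Z := (dcst _ 0).
Local Notation X := (dvar _).

Definition Azero := Ssf Z Z Z Z.
Definition Aadd a b := Ssf (a0 a +' a0 b) (a1 a +' a1 b) (a2 a +' a2 b) (a3 a +' a3 b).
Definition Aopp a := Ssf (-' a0 a) (-' a1 a) (-' a2 a) (-' a3 a).
Definition Ascale k a := Ssf (k *:' a0 a) (k *:' a1 a) (k *:' a2 a) (k *:' a3 a).
Definition Amul a b := Ssf (a0 a *' a0 b)
  (a0 a *' a1 b +' a1 a *' a0 b) (a0 a *' a2 b +' a2 a *' a0 b)
  (a0 a *' a3 b +' a3 a *' a0 b +' a1 a *' a2 b +' (-' (a2 a *' a1 b))).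
Definition Adx a := Ssf (\d (a0 a)) (\d (a1 a)) (\d (a2 a)) (\d (a3 a)).
Definition AD1 a := Ssf (a1 a) (-' (\d (a0 a))) (a3 a) (-' (\d (a2 a))).
Definition AD2 a := Ssf (a2 a) (-' a3 a) (-' (\d (a0 a))) (\d (a1 a)).
Definition Aev a := Ssf (a0 a) Z Z (a3 a).
Definition Aod a := Ssf Z (a1 a) (a2 a) Z.
Definition Apar a := Ssf (a0 a) (-' a1 a) (-' a2 a) (a3 a).

Declare Scope super_scope.
Local Open Scope super_scope.
Local Notation "a + b" := (Aadd a b) : super_scope.
Local Notation "a - b" := (Aadd a (Aopp b)) : super_scope.
Local Notation "k *: a" := (Ascale k a) : super_scope.
Local Notation "a * b" := (Amul a b) : super_scope.
Local Notation "- a" := (Aopp a) : super_scope.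
Local Notation half := (1 / 2 : F)%R.

(* L^h_{X_F} for the generator F, written out on components. *)
Definition LS h (Y : ospgen) g : ssf :=
  let: Ssf g0 g1 g2 g3 := g in
  let lin k (u : A) := X *' \d u +' k *:' u in
  let quad k (u : A) := X *' X *' \d u +' (2 * k)%R *:' (X *' u) in
  match Y with
  | G1 => Adx g
  | Gx => Ssf (lin h g0) (lin (h + half)%R g1) (lin (h + half)%R g2) (lin (h + 1)%R g3)
  | Gx2 => Ssf (quad h g0) (quad (h + half)%R g1) (quad (h + half)%R g2) (quad (h + 1)%R g3)
  | Gxi12 => Ssf Z (half *:' g2) ((- half)%R *:' g1) Z
  | Gxi1 => Ssf (half *:' g1) (half *:' \d g0) (half *:' g3) (half *:' \d g2)
  | Gxi2 => Ssf (half *:' g2) ((- half)%R *:' g3) (half *:' \d g0) ((- half)%R *:' \d g1)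
  | Gxxi1 => Ssf (half *:' (X *' g1)) (half *:' (X *' \d g0) +' h *:' g0)
      (half *:' (X *' g3)) (half *:' (X *' \d g2) +' (h + half)%R *:' g2)
  | Gxxi2 => Ssf (half *:' (X *' g2)) ((- half)%R *:' (X *' g3))
      (half *:' (X *' \d g0) +' h *:' g0)
      ((- half)%R *:' (X *' \d g1) +' (- h - half)%R *:' g1)
  end.

(* For the generator F, with e_i = -(-1)^p(F) Dbar_i(F') and the sign
   (-1)^(p(F) p(c)) in front: [RS] is c D1 D2 (F) / 2, [E1S], [E2S] and [ES] are
   c e_1, c e_2 and c F''. *)
Definition RS (Y : ospgen) c : ssf :=
  match Y with
  | Gx2 => Ssf Z Z Z (a0 c)
  | Gxi12 => (- half)%R *: c
  | Gxxi1 => half *: Ssf Z Z (a0 c) (-' a1 c)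
  | Gxxi2 => (- half)%R *: Ssf Z (a0 c) Z (a2 c)
  | _ => Azero
  end.

Definition E1S (Y : ospgen) c : ssf :=
  match Y with
  | Gx2 => 2 *: Ssf Z (a0 c) Z (-' a2 c)
  | Gxxi1 => Apar c
  | _ => Azero
  end.

Definition E2S (Y : ospgen) c : ssf :=
  match Y with
  | Gx2 => 2 *: Ssf Z Z (a0 c) (a1 c)
  | Gxxi2 => Apar c
  | _ => Azero
  end.

Definition ES (Y : ospgen) c : ssf := if Y is Gx2 then 2 *: c else Azero.

(* Coefficients in D^2: the index is twice the weight, and the letters t, u, p, q
   stand for dx^l, dx^l Dbar1 Dbar2, dx^l Dbar1, dx^l Dbar2. *)
Record grs := Grs { t0 : ssf; p1 : ssf; q1 : ssf; t2 : ssf; u2 : ssf;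
  p3 : ssf; q3 : ssf; t4 : ssf; u4 : ssf }.
Implicit Types s : grs.

Definition opgS s g : ssf :=
  t0 s * g + p1 s * AD1 g + q1 s * AD2 g + t2 s * Adx g + u2 s * AD1 (AD2 g)
  + p3 s * Adx (AD1 g) + q3 s * Adx (AD2 g) + t4 s * Adx (Adx g)
  + u4 s * Adx (AD1 (AD2 g)).

(** For odd X_F the sign (-1)^p(B) is imposed by subtracting the odd part of [B], applied to [h],
    from the even part. *)
Definition LopS lam mu Y (B : ssf -> ssf) g : ssf :=
  let h := LS lam Y g in
  if gen_odd Y then
    LS mu Y (B g) - ((Aev (B (Aev h)) + Aod (B (Aod h)))
                     - (Aod (B (Aev h)) + Aev (B (Aod h))))
  else LS mu Y (B g) - B h.

Definition actG del Y s : grs :=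
  let L k := LS (del - k)%R Y in
  Grs (L 0 (t0 s)) (L half (p1 s) - RS Y (q1 s)) (L half (q1 s) + RS Y (p1 s))
    (L 1 (t2 s)) (L 1 (u2 s))
    (L (3 / 2)%R (p3 s) - RS Y (q3 s)) (L (3 / 2)%R (q3 s) + RS Y (p3 s))
    (L 2 (t4 s)) (L 2 (u4 s)).

(** Coefficients move down by 1/2 in k through Dbar_i(F') and by 1 through F''. Nothing else occurs:
    F'' is constant and Dbar1 Dbar2 (F') = 0 for the eight generators. *)
Definition actN lam Y s : grs :=
  Grs (lam *: (E1S Y (p1 s) + E2S Y (q1 s) - ES Y (t2 s)))
    (- ((lam + half)%R *: (E2S Y (u2 s) + ES Y (p3 s)) + half *: E1S Y (t2 s)))
    ((lam + half)%R *: (E1S Y (u2 s) - ES Y (q3 s)) - half *: E2S Y (t2 s))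
    ((lam + half)%R *: (E1S Y (p3 s) + E2S Y (q3 s) - 2 *: ES Y (t4 s)))
    (half *: (E2S Y (p3 s) - E1S Y (q3 s)) - (lam + 1)%R *: ES Y (u4 s))
    (- ((lam + 1)%R *: E2S Y (u4 s) + E1S Y (t4 s)))
    ((lam + 1)%R *: E1S Y (u4 s) - E2S Y (t4 s))
    Azero Azero.

Definition Gadd s s' : grs := Grs (t0 s + t0 s') (p1 s + p1 s') (q1 s + q1 s')
  (t2 s + t2 s') (u2 s + u2 s') (p3 s + p3 s') (q3 s + q3 s')
  (t4 s + t4 s') (u4 s + u4 s').
Definition Gscale k s : grs := Grs (k *: t0 s) (k *: p1 s) (k *: q1 s)
  (k *: t2 s) (k *: u2 s) (k *: p3 s) (k *: q3 s) (k *: t4 s) (k *: u4 s).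

Definition actD lam del Y s := Gadd (actG del Y s) (actN lam Y s).

(** Instance search computes the jets of both sides, and [cbn] leaves an identity between
    polynomials in the derivatives of the atoms. *)
Ltac jet_eval := simpl; (eapply jet_eq; [typeclasses eauto | typeclasses eauto |]);
  cbn [leibniz iter].
Ltac jet_ring := jet_eval; field.
Ltac ssf_ring := apply: ssf_ext => x; jet_ring.

Lemma LopSE lam del Y s g :
  LopS lam (lam + del)%R Y (opgS s) g = opgS (actD lam del Y s) g.
Proof.
case: s => [[? ? ? ?] [? ? ? ?] [? ? ? ?] [? ? ? ?] [? ? ? ?]
  [? ? ? ?] [? ? ? ?] [? ? ? ?] [? ? ? ?]].
case: g => ? ? ? ?.
case: Y; apply: ssf_ext => x; abstract (by jet_ring).
Qed.

(** * The explicit quantization *)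

Section Quantization.
Variables lam del : F.

(** The inverses are named so that [field] sees them as atoms: linearity and inversion of [q0] then
    hold for every [del], and only equivariance unfolds them. *)
Definition c0 : F := del^-1.
Definition c1 : F := (del - 1)^-1.
Definition c2 : F := (del - 2)^-1.
Definition c12 : F := ((del - 1) * (2 * del - 1))^-1.
Definition c23 : F := ((del - 2) * (2 * del - 3))^-1.

(** In the names [n3p] to [n0t] the digit is the target level and the letter the target coefficient;
    the arguments are symbols of strictly higher levels. *)
Definition n3p t4 u4 := ((- c2)%R *: Apar (AD1 t4 + (lam + 1)%R *: AD2 u4)).
Definition n3q t4 u4 := ((- c2)%R *: Apar (AD2 t4 - (lam + 1)%R *: AD1 u4)).
Definition n2t p3 q3 t4 u4 :=
  (((lam + half) * c1)%R *: Apar (AD1 p3 + AD2 q3)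
   - ((2 * lam + 1) * c2)%R *: Adx t4
   + ((lam + 1) * (2 * lam + 1) * c23)%R *: AD1 (AD2 u4)).
Definition n2u p3 q3 t4 u4 :=
  ((half * c1)%R *: Apar (AD2 p3 - AD1 q3)
   - ((lam + 1) * c2)%R *: Adx u4 - c23 *: AD1 (AD2 t4)).
Definition n1p t2 u2 p3 q3 t4 u4 :=
  ((- c1)%R *: Apar (half *: AD1 t2 + (lam + half)%R *: AD2 u2)
   + ((2 * lam + 1) / 4 * c1 ^+ 2)%R *: ((1 - 2 * del)%R *: Adx p3 + AD1 (AD2 q3))
   + ((2 * lam + 1) * c23)%R *: Apar (Adx (AD1 t4 + (lam + 1)%R *: AD2 u4))).
Definition n1q t2 u2 p3 q3 t4 u4 :=
  ((- c1)%R *: Apar (half *: AD2 t2 - (lam + half)%R *: AD1 u2)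
   + ((2 * lam + 1) / 4 * c1 ^+ 2)%R *: ((1 - 2 * del)%R *: Adx q3 - AD1 (AD2 p3))
   + ((2 * lam + 1) * c23)%R *: Apar (Adx (AD2 t4 - (lam + 1)%R *: AD1 u4))).
Definition n0t p1 q1 t2 u2 p3 q3 t4 u4 :=
  ((lam * c0)%R *: Apar (AD1 p1 + AD2 q1)
   + (lam * (2 * lam + 1) * c12)%R *: AD1 (AD2 u2) - (lam * c1)%R *: Adx t2
   - (lam * (2 * lam + 1) / 2 * c1 ^+ 2)%R *: Apar (Adx (AD1 p3 + AD2 q3))
   + (lam * (2 * lam + 1) * c23)%R *:
       (Adx (Adx t4) - ((lam + 1) * c1)%R *: Adx (AD1 (AD2 u4)))).

Definition q0 s : grs :=
  let: Grs t0 p1 q1 t2 u2 p3 q3 t4 u4 := s in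
  Grs (t0 + n0t p1 q1 t2 u2 p3 q3 t4 u4) (p1 + n1p t2 u2 p3 q3 t4 u4)
    (q1 + n1q t2 u2 p3 q3 t4 u4) (t2 + n2t p3 q3 t4 u4) (u2 + n2u p3 q3 t4 u4)
    (p3 + n3p t4 u4) (q3 + n3q t4 u4) t4 u4.

Hypotheses (d0 : del != 0) (d1 : (del - 1 != 0)%R) (d2 : (del - 2 != 0)%R)
  (d12 : (2 * del - 1 != 0)%R) (d32 : (2 * del - 3 != 0)%R).

(** The corrections absorb [actN]: on jets one rational identity in [lam] and [del] per component
    remains, with denominators nonzero by hypothesis. *)
Lemma q0_equiv Y s : actD lam del Y (q0 s) = q0 (actG del Y s).
Proof.
case: s => [[? ? ? ?] [? ? ? ?] [? ? ? ?] [? ? ? ?] [? ? ? ?]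
  [? ? ? ?] [? ? ? ?] [? ? ? ?] [? ? ? ?]].
case: Y; congr Grs; apply: ssf_ext => x;
  abstract (by jet_eval; rewrite /c0 /c1 /c2 /c12 /c23; field;
    rewrite ?d0 ?d1 ?d2 ?d12 ?d32).
Qed.

End Quantization.

Lemma AaddC a b : a + b = b + a.
Proof. by ssf_ring. Qed.
Lemma AaddA a b c : a + (b + c) = a + b + c.
Proof. by ssf_ring. Qed.
Lemma Aadd0 a : a + Azero = a.
Proof. by ssf_ring. Qed.
Lemma A0add a : Azero + a = a.
Proof. by ssf_ring. Qed.
Lemma AaddK a b : a + b - b = a.
Proof. by ssf_ring. Qed.
Lemma AsubK a b : a - b + b = a.
Proof. by ssf_ring. Qed.
Lemma Asubb a : a - a = Azero.
Proof. by ssf_ring. Qed.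
Lemma Ascale0 k : k *: Azero = Azero.
Proof. by ssf_ring. Qed.
Lemma A0scale a : 0 *: a = Azero.
Proof. by ssf_ring. Qed.
Lemma Ascale1 a : 1 *: a = a.
Proof. by ssf_ring. Qed.
Lemma AscaleA k h a : k *: (h *: a) = (k * h)%R *: a.
Proof. by ssf_ring. Qed.
Lemma AscaleBl k h a : (k - h)%R *: a = k *: a - h *: a.
Proof. by ssf_ring. Qed.
Lemma Amul0 a : Azero * a = Azero.
Proof. by ssf_ring. Qed.
Lemma LS0 h Y : LS h Y Azero = Azero.
Proof. by case: Y; ssf_ring. Qed.
Lemma RS0 Y : RS Y Azero = Azero.
Proof. by case: Y; ssf_ring. Qed.

Lemma Ascale_eq0 k a : k != 0 -> k *: a = Azero -> a = Azero.
Proof.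
by move=> k0 /(congr1 (Ascale k^-1)); rewrite AscaleA mulVf// Ascale1 Ascale0.
Qed.

(** In this form distinct eigenvalues of a Casimir element separate the levels. *)
Lemma Ascale_inj k h a : k != h -> k *: a = h *: a -> a = Azero.
Proof.
by rewrite -subr_eq0 => kh e; apply: (Ascale_eq0 kh); rewrite AscaleBl e Asubb.
Qed.

(** * Casimir elements *)

Section Casimir.
Variable del : F.
Local Notation "s +g r" := (Gadd s r) (at level 50, left associativity).
Local Notation "k *g s" := (Gscale k s) (at level 40).
Local Notation L := (actG del).

(* The quadratic and cubic Casimir elements of osp(2|2). *)
Definition odd_pair s : grs := L Gxi1 (L Gxxi1 s) +g L Gxi2 (L Gxxi2 s).
Definition odd_cross s : grs := L Gxi1 (L Gxxi2 s) +g -1 *g L Gxi2 (L Gxxi1 s).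

Definition casimir s : grs :=
  L Gx (L Gx s) +g -1 *g L G1 (L Gx2 s) +g L Gxi12 (L Gxi12 s) +g 2 *g odd_pair s.

Definition casimir3 s : grs :=
  L Gxi12 (casimir s) +g L Gxi12 (odd_pair s)
  +g -1 *g (odd_cross s +g L Gx (odd_cross s))
  +g L G1 (L Gxxi1 (L Gxxi2 s)) +g L Gxi1 (L Gxi2 (L Gx2 s)).

(** At weight h = del - k this is the factor of the cubic Casimir element on a half-integral level;
    it vanishes exactly at h = 1/2 and h = -1/2. *)
Definition kap h : F := ((h ^+ 2 - 1 / 4) / 2)%R.

Lemma casimirE s : [/\ t0 (casimir s) = (del ^+ 2)%R *: t0 s,
  t2 (casimir s) = ((del - 1) ^+ 2)%R *: t2 s,
  u2 (casimir s) = ((del - 1) ^+ 2)%R *: u2 s,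
  t4 (casimir s) = ((del - 2) ^+ 2)%R *: t4 s &
  u4 (casimir s) = ((del - 2) ^+ 2)%R *: u4 s].
Proof.
case: s => [[? ? ? ?] ? ? [? ? ? ?] [? ? ? ?] ? ? [? ? ? ?] [? ? ? ?]].
by split; ssf_ring.
Qed.

Lemma casimir3_even s : [/\ t0 (casimir3 s) = Azero,
  t2 (casimir3 s) = Azero, u2 (casimir3 s) = Azero,
  t4 (casimir3 s) = Azero & u4 (casimir3 s) = Azero].
Proof.
case: s => [[? ? ? ?] ? ? [? ? ? ?] [? ? ? ?] ? ? [? ? ? ?] [? ? ? ?]].
by split; ssf_ring.
Qed.

(** On a pair of half-integral level the cubic element is [kap] times a rotation by a right angle,
    so that its square is a scalar. *)
Lemma casimir3_odd s : [/\ p1 (casimir3 s) = kap (del - 1 / 2)%R *: q1 s,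
  q1 (casimir3 s) = (- kap (del - 1 / 2))%R *: p1 s,
  p3 (casimir3 s) = kap (del - 3 / 2)%R *: q3 s &
  q3 (casimir3 s) = (- kap (del - 3 / 2))%R *: p3 s].
Proof.
case: s => [? [? ? ? ?] [? ? ? ?] ? ? [? ? ? ?] [? ? ? ?] ? ?].
rewrite /kap.
by split; ssf_ring.
Qed.
End Casimir.

(** * Inversion and linearity of the explicit map *)

Section Inverse.
Variables lam del : F.

(** Back substitution from the top level down: each correction uses only coefficients already
    recovered. *)
Definition q0inv s : grs :=
  let: Grs t0 p1 q1 t2 u2 p3 q3 t4 u4 := s in
  let p3 := p3 - n3p lam del t4 u4 in
  let q3 := q3 - n3q lam del t4 u4 in
  let t2 := t2 - n2t lam del p3 q3 t4 u4 in
  let u2 := u2 - n2u lam del p3 q3 t4 u4 in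
  let p1 := p1 - n1p lam del t2 u2 p3 q3 t4 u4 in
  let q1 := q1 - n1q lam del t2 u2 p3 q3 t4 u4 in
  Grs (t0 - n0t lam del p1 q1 t2 u2 p3 q3 t4 u4) p1 q1 t2 u2 p3 q3 t4 u4.

Lemma q0invK s : q0 lam del (q0inv s) = s.
Proof. by case: s => *; rewrite /q0inv /q0 !AsubK. Qed.

Lemma q0K s : q0inv (q0 lam del s) = s.
Proof. by case: s => *; rewrite /q0inv /q0 !AaddK. Qed.

Lemma q0_lin k h s r :
  q0 lam del (Gadd (Gscale k s) (Gscale h r)) =
  Gadd (Gscale k (q0 lam del s)) (Gscale h (q0 lam del r)).
Proof.
case: s r => [? ? ? ? ? ? ? ? ?] [? ? ? ? ? ? ? ? ?].
rewrite /q0 /Gadd /Gscale /=.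
by congr Grs; ssf_ring.
Qed.
End Inverse.

(** * Contact fields of the generators and the grading by order *)

Local Notation O := Azero.
Local Notation Gzero := (Grs O O O O O O O O O).
Local Notation "s +g r" := (Gadd s r) (at level 50, left associativity).
Local Notation "k *g s" := (Gscale k s) (at level 40).

Definition genS (Y : ospgen) : ssf :=
  match Y with
  | G1 => Ssf (dcst A 1) Z Z Z
  | Gx => Ssf X Z Z Z
  | Gx2 => Ssf (X *' X) Z Z Z
  | Gxi12 => Ssf Z Z Z (dcst A 1)
  | Gxi1 => Ssf Z (dcst A 1) Z Z
  | Gxi2 => Ssf Z Z (dcst A 1) Z
  | Gxxi1 => Ssf Z X Z Z
  | Gxxi2 => Ssf Z Z X Z
  end.

Lemma LSE h Y g : LS h Y g =
  let f := genS Y in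
  f * Adx g + ((- ((-1) ^+ gen_odd Y) / 2)%R *: (AD1 f * AD1 g + AD2 f * AD2 g))
  + h *: (Adx f * g).
Proof. by case: g => [? ? ? ?]; case: Y; ssf_ring. Qed.

(* The component of [s] in gr^{K/2}. *)
Definition lev K s : grs :=
  let: Grs t0 p1 q1 t2 u2 p3 q3 t4 u4 := s in
  match K with
  | 0 => Grs t0 O O O O O O O O
  | 1 => Grs O p1 q1 O O O O O O
  | 2 => Grs O O O t2 u2 O O O O
  | 3 => Grs O O O O O p3 q3 O O
  | 4 => Grs O O O O O O O t4 u4
  | _ => Gzero
  end.

(** Order strictly less than K/2: the counterpart of [Dlt K] on coefficients. *)
Definition below K s : Prop := forall K', (K <= K')%N -> lev K' s = Gzero.

Ltac gcbn := rewrite /actG /actN /q0 /Gadd /Gscale; 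
  cbn [lev t0 p1 q1 t2 u2 p3 q3 t4 u4].

Lemma lev_sum s : s = lev 0 s +g (lev 1 s +g (lev 2 s +g (lev 3 s +g lev 4 s))).
Proof. by case: s => *; rewrite /Gadd /= ?Aadd0 ?A0add ?Aadd0 ?A0add. Qed.

Lemma lev0E s : lev 0 s = Grs (t0 s) O O O O O O O O. Proof. by case: s. Qed.
Lemma lev1E s : lev 1 s = Grs O (p1 s) (q1 s) O O O O O O. Proof. by case: s. Qed.
Lemma lev2E s : lev 2 s = Grs O O O (t2 s) (u2 s) O O O O. Proof. by case: s. Qed.
Lemma lev3E s : lev 3 s = Grs O O O O O (p3 s) (q3 s) O O. Proof. by case: s. Qed.
Lemma lev4E s : lev 4 s = Grs O O O O O O O (t4 s) (u4 s). Proof. by case: s. Qed.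

Lemma lev_idem K s : lev K (lev K s) = lev K s.
Proof. by case: s => *; case: K => [|[|[|[|[|K]]]]]. Qed.

Lemma levD K s r : lev K (s +g r) = lev K s +g lev K r.
Proof.
by case: s r => [? ? ? ? ? ? ? ? ?] [? ? ? ? ? ? ? ? ?];
  case: K => [|[|[|[|[|K]]]]]; rewrite /Gadd /= ?Aadd0.
Qed.

Lemma levZ K k s : lev K (k *g s) = k *g lev K s.
Proof.
by case: s => *; case: K => [|[|[|[|[|K]]]]]; rewrite /Gscale /= ?Ascale0.
Qed.

Lemma lev_actG del Y K s : actG del Y (lev K s) = lev K (actG del Y s).
Proof.
by case: s => *; case: K => [|[|[|[|[|K]]]]];
  gcbn; rewrite !(LS0, RS0, Asubb, Aadd0).
Qed.

Lemma Aopp0 : - O = O. Proof. by ssf_ring. Qed.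
Lemma E1S0 Y : E1S Y O = O. Proof. by case: Y; ssf_ring. Qed.
Lemma E2S0 Y : E2S Y O = O. Proof. by case: Y; ssf_ring. Qed.
Lemma ES0 Y : ES Y O = O. Proof. by case: Y; ssf_ring. Qed.

Definition zE := (Aopp0, E1S0, E2S0, ES0, LS0, RS0, Aadd0, A0add, Ascale0, Amul0).

Lemma actN_below lam Y K s : below K (actN lam Y (lev K s)).
Proof.
by case: s => *; case: K => [|[|[|[|[|K]]]]] [|[|[|[|[|K']]]]] // _;
  gcbn; rewrite ?zE.
Qed.

Lemma lev_odd_pair del K s : odd_pair del (lev K s) = lev K (odd_pair del s).
Proof. by rewrite /odd_pair !(lev_actG, levD). Qed.

Lemma lev_odd_cross del K s : odd_cross del (lev K s) = lev K (odd_cross del s).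
Proof. by rewrite /odd_cross !(lev_actG, levD, levZ). Qed.

Lemma lev_casimir del K s : casimir del (lev K s) = lev K (casimir del s).
Proof. by rewrite /casimir lev_odd_pair !(lev_actG, levD, levZ). Qed.

Lemma lev_casimir3 del K s : casimir3 del (lev K s) = lev K (casimir3 del s).
Proof.
by rewrite /casimir3 lev_casimir lev_odd_pair lev_odd_cross !(lev_actG, levD, levZ).
Qed.

Lemma Gadd0 s : s +g Gzero = s.
Proof. by case: s => *; rewrite /Gadd /= !Aadd0. Qed.
Lemma AoppE a : - a = -1 *: a.
Proof. by ssf_ring. Qed.

Lemma Gsubb s : s +g -1 *g s = Gzero.
Proof. by case: s => *; rewrite /Gadd /Gscale /= -!AoppE !Asubb. Qed.

Lemma Gsub_eq0 s r : s +g -1 *g r = Gzero -> s = r.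
Proof.
case: s r => [? ? ? ? ? ? ? ? ?] [? ? ? ? ? ? ? ? ?].
have sub_eq0 a b : a + -1 *: b = O -> a = b.
  move=> e; rewrite -(AsubK a b) (_ : a - b = O) ?A0add// -e.
  by ssf_ring.
move=> e; congr Grs; apply: sub_eq0;
  [exact: (congr1 t0 e)|exact: (congr1 p1 e)|exact: (congr1 q1 e)
  |exact: (congr1 t2 e)|exact: (congr1 u2 e)|exact: (congr1 p3 e)
  |exact: (congr1 q3 e)|exact: (congr1 t4 e)|exact: (congr1 u4 e)].
Qed.

Section Triangular.
Variables (lam del : F).

Lemma n3p0 : n3p lam del O O = O. Proof. by ssf_ring. Qed.
Lemma n3q0 : n3q lam del O O = O. Proof. by ssf_ring. Qed.
Lemma n2t0 : n2t lam del O O O O = O. Proof. by ssf_ring. Qed.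
Lemma n2u0 : n2u lam del O O O O = O. Proof. by ssf_ring. Qed.
Lemma n1p0 : n1p lam del O O O O O O = O. Proof. by ssf_ring. Qed.
Lemma n1q0 : n1q lam del O O O O O O = O. Proof. by ssf_ring. Qed.
Lemma n0t0 : n0t lam del O O O O O O O O = O. Proof. by ssf_ring. Qed.

Definition nE := (n3p0, n3q0, n2t0, n2u0, n1p0, n1q0, n0t0).

(** Unitriangularity of [q0]: the corrections of a level [K] symbol live in lower levels, so the
    principal symbol is kept. *)
Lemma q0_lev_below K s : below K (q0 lam del (lev K s) +g -1 *g lev K s).
Proof.
have cancel a : a + -1 *: a = O by ssf_ring.
by case: s => *; case: K => [|[|[|[|[|K]]]]] [|[|[|[|[|K']]]]] // _;
  gcbn; rewrite ?nE ?Aadd0 ?cancel ?Ascale0 ?Aadd0.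
Qed.
End Triangular.

(** * Rigidity of the graded module *)

Section Rigidity.
Variables (lam del : F).
Hypotheses (d0 : del != 0) (d1 : (del - 1 != 0)%R) (d2 : (del - 2 != 0)%R)
  (d12 : (2 * del - 1 != 0)%R) (d32 : (2 * del - 3 != 0)%R).
(** [b] abstracts the comparison of another equivariant quantization with the explicit one: its
    coefficients followed by the inverse of [q0]. By [b_top] its principal symbols are the right
    ones. *)
Variable b : grs -> grs.
Hypothesis b_lin : forall k h s r, b (k *g s +g h *g r) = k *g b s +g h *g b r.
Hypothesis b_act : forall Y s, b (actG del Y s) = actG del Y (b s).
Hypothesis b_top : forall K s, (K < 5)%N ->
  below K (q0 lam del (b (lev K s)) +g -1 *g lev K s).

Lemma Gscale1 s : 1 *g s = s.
Proof. by case: s => *; rewrite /Gscale /= !Ascale1. Qed.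
Lemma G0scale s : 0 *g s = Gzero.
Proof. by case: s => *; rewrite /Gscale /= !A0scale. Qed.

Lemma rigid_add s r : b (s +g r) = b s +g b r.
Proof. by have := b_lin 1 1 s r; rewrite !Gscale1. Qed.
Lemma rigid_scale k s : b (k *g s) = k *g b s.
Proof. by have := b_lin k 0 s s; rewrite !G0scale !Gadd0. Qed.

Lemma rigid_casimir s : b (casimir del s) = casimir del (b s).
Proof. by rewrite /casimir /odd_pair !(rigid_add, rigid_scale, b_act). Qed.
Lemma rigid_casimir3 s : b (casimir3 del s) = casimir3 del (b s).
Proof.
by rewrite /casimir3 /casimir /odd_pair /odd_cross !(rigid_add, rigid_scale, b_act).
Qed.

Lemma rigid_top K s K' : (K < 5)%N -> (K <= K')%N ->
  lev K' (q0 lam del (b (lev K s))) = lev K' (lev K s).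
Proof.
by move=> K5 KK'; apply: Gsub_eq0; rewrite -levZ -levD b_top.
Qed.

Lemma rigid_casimir_lev K k s : casimir del (lev K s) = k *g lev K s ->
  casimir del (b (lev K s)) = k *g b (lev K s).
Proof. by move=> e; rewrite -rigid_casimir e rigid_scale. Qed.

Lemma rigid_casimir3_even K s : casimir3 del (lev K s) = Gzero ->
  casimir3 del (b (lev K s)) = Gzero.
Proof.
move=> e; rewrite -rigid_casimir3 e.
by have := rigid_scale 0 Gzero; rewrite !G0scale.
Qed.

Lemma rigid_casimir3_odd K k s :
  casimir3 del (casimir3 del (lev K s)) = k *g lev K s ->
  casimir3 del (casimir3 del (b (lev K s))) = k *g b (lev K s).
Proof. by move=> e; rewrite -!rigid_casimir3 e rigid_scale. Qed.

Local Notation h1 := (kap (del - 1 / 2)).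
Local Notation h3 := (kap (del - 3 / 2)).

(** In factored form the roots 0, 1 and 2 are visibly excluded values of [del]. *)
Lemma kap1E : h1 = (del * (del - 1) / 2)%R. Proof. by rewrite /kap; field. Qed.
Lemma kap3E : h3 = ((del - 1) * (del - 2) / 2)%R. Proof. by rewrite /kap; field. Qed.
Lemma kap1_neq0 : h1 != 0.
Proof. by rewrite kap1E !mulf_neq0// invr_eq0 pnatr_eq0. Qed.
Lemma kap3_neq0 : h3 != 0.
Proof. by rewrite kap3E !mulf_neq0// invr_eq0 pnatr_eq0. Qed.

Lemma kap13 : (- h3 ^+ 2 != - h1 ^+ 2)%R.
Proof.
rewrite -subr_eq0 kap1E kap3E.
(* With both constants factored the difference is (del - 1)^2 (del^2 - (del - 2)^2) / 4. *)
rewrite (_ : (_ - _)%R = ((del - 1) ^+ 3))%R; last by field.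
by rewrite expf_neq0.
Qed.

Lemma casimir_lev2 s : casimir del (lev 2 s) = ((del - 1) ^+ 2)%R *g lev 2 s.
Proof.
rewrite lev_casimir -levZ; have [_ e0 e1 _ _] := casimirE del s.
by rewrite !lev2E e0 e1.
Qed.

Lemma casimir_lev4 s : casimir del (lev 4 s) = ((del - 2) ^+ 2)%R *g lev 4 s.
Proof.
rewrite lev_casimir -levZ; have [_ _ _ e0 e1] := casimirE del s.
by rewrite !lev4E e0 e1.
Qed.

Lemma casimir3_lev2 s : casimir3 del (lev 2 s) = Gzero.
Proof.
rewrite lev_casimir3; have [_ e0 e1 _ _] := casimir3_even del s.
by rewrite !lev2E e0 e1.
Qed.

Lemma casimir3_lev4 s : casimir3 del (lev 4 s) = Gzero.
Proof.
rewrite lev_casimir3; have [_ _ _ e0 e1] := casimir3_even del s.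
by rewrite !lev4E e0 e1.
Qed.

Lemma casimir3_sqr s : let r := casimir3 del (casimir3 del s) in
  [/\ [/\ t0 r = O, t2 r = O & u2 r = O],
    p1 r = (- h1 ^+ 2)%R *: p1 s, q1 r = (- h1 ^+ 2)%R *: q1 s,
    p3 r = (- h3 ^+ 2)%R *: p3 s & q3 r = (- h3 ^+ 2)%R *: q3 s].
Proof.
move=> r; have [e1 e2 e3 e4] := casimir3_odd del (casimir3 del s).
have [f1 f2 f3 f4] := casimir3_odd del s.
have [g1 g2 g3 _ _] := casimir3_even del (casimir3 del s).
by rewrite /r g1 g2 g3 e1 e2 e3 e4 f1 f2 f3 f4 !AscaleA !mulrN !mulNr -!expr2.
Qed.

Lemma casimir3_lev1 s :
  casimir3 del (casimir3 del (lev 1 s)) = (- h1 ^+ 2)%R *g lev 1 s.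
Proof.
rewrite !lev_casimir3 -levZ; have [_ e1 e2 _ _] := casimir3_sqr s.
by rewrite !lev1E e1 e2.
Qed.

Lemma casimir3_lev3 s :
  casimir3 del (casimir3 del (lev 3 s)) = (- h3 ^+ 2)%R *g lev 3 s.
Proof.
rewrite !lev_casimir3 -levZ; have [_ _ _ e1 e2] := casimir3_sqr s.
by rewrite !lev3E e1 e2.
Qed.

(** Read from the top, [b_top] fixes the components of level [K] and above: those above [K] vanish,
    hence so do the corrections. The components below [K] are killed by comparing eigenvalues of the
    Casimir elements. *)
Lemma rigid_level K s : (K < 5)%N -> b (lev K s) = lev K s.
Proof.
case: s => [t0s p1s q1s t2s u2s p3s q3s t4s u4s]; set s := Grs _ _ _ _ _ _ _ _ _.
move: (@rigid_top K s); case Et : (b (lev K s)) => [t0r p1r q1r t2r u2r p3r q3r t4r u4r].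
case: K Et => [|[|[|[|[|//]]]]] Et top _.
all: have {}top K' := top K' isT.
(* Goal number K + 1 treats level [K], so the range of goals shrinks as lower levels are read
   off. *)
all: have e4 : t4r = _ := congr1 t4 (top 4 isT).
all: have f4 : u4r = _ := congr1 u4 (top 4 isT).
1-4: have e3 : p3r + n3p lam del t4r u4r = _ := congr1 p3 (top 3 isT).
1-4: have f3 : q3r + n3q lam del t4r u4r = _ := congr1 q3 (top 3 isT).
1-4: cbn [lev t4 u4 p3 q3] in e4, f4, e3, f3; rewrite e4 f4 ?nE ?Aadd0 in e3, f3.
1-3: have e2 : t2r + n2t lam del p3r q3r t4r u4r = _ := congr1 t2 (top 2 isT).
1-3: have f2 : u2r + n2u lam del p3r q3r t4r u4r = _ := congr1 u2 (top 2 isT).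
1-3: cbn [lev t2 u2] in e2, f2; rewrite e4 f4 e3 f3 ?nE ?Aadd0 in e2, f2.
1-2: have e1 : p1r + n1p lam del t2r u2r p3r q3r t4r u4r = _ :=
  congr1 p1 (top 1%N isT).
1-2: have f1 : q1r + n1q lam del t2r u2r p3r q3r t4r u4r = _ :=
  congr1 q1 (top 1%N isT).
1-2: cbn [lev p1 q1] in e1, f1; rewrite e4 f4 e3 f3 e2 f2 ?nE ?Aadd0 in e1, f1.
1: have e0 : t0r + n0t lam del p1r q1r t2r u2r p3r q3r t4r u4r = _ :=
  congr1 t0 (top 0%N isT).
1: cbn [lev t0] in e0; rewrite e4 f4 e3 f3 e2 f2 e1 f1 ?nE ?Aadd0 in e0.
- by rewrite /s e4 f4 e3 f3 e2 f2 e1 f1 e0.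
(* K = 1: the squared cubic element kills [t0] but acts on the image by a nonzero scalar. *)
- have := rigid_casimir3_odd (casimir3_lev1 s); rewrite Et => /(congr1 t0).
  have [[-> _ _] _ _ _ _] := casimir3_sqr (Grs t0r p1r q1r t2r u2r p3r q3r t4r u4r).
  move=> /esym /Ascale_eq0 e0; cbn [t0] in e0.
  rewrite /s e4 f4 e3 f3 e2 f2 e1 f1 e0//.
  by rewrite oppr_eq0 expf_neq0// kap1_neq0.
(* K = 2: the cubic element kills the image, hence its level 1 part; the quadratic eigenvalues del^2
   and (del - 1)^2 then compete on [t0] and differ by 2 del - 1. *)
- have := rigid_casimir3_even (casimir3_lev2 s); rewrite Et => c3.
  have [E1 F1 _ _] := casimir3_odd del (Grs t0r p1r q1r t2r u2r p3r q3r t4r u4r).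
  rewrite c3 /= in E1 F1.
  have f1 := Ascale_eq0 kap1_neq0 (esym E1).
  have e1 := Ascale_eq0 (_ : - h1 != 0)%R (esym F1).
  have := rigid_casimir_lev (casimir_lev2 s); rewrite Et => /(congr1 t0).
  have [-> _ _ _ _] := casimirE del (Grs t0r p1r q1r t2r u2r p3r q3r t4r u4r).
  move=> /Ascale_inj e0; cbn [t0] in e0; rewrite /s e4 f4 e3 f3 e2 f2 e1 ?f1 ?e0//.
    by rewrite -subr_eq0 (_ : _ - _ = 2 * del - 1)%R//; ring.
  by rewrite oppr_eq0 kap1_neq0.
(* K = 3: the squared cubic element is 0 on integral levels and - h1^2 on level 1; neither equals -
   h3^2. *)
- have := rigid_casimir3_odd (casimir3_lev3 s); rewrite Et => c3.
  have [[E0 E2 F2] E1 F1 _ _] := casimir3_sqr (Grs t0r p1r q1r t2r u2r p3r q3r t4r u4r).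
  rewrite c3 in E0 E2 F2 E1 F1; cbn [Gscale t0 p1 q1 t2 u2] in E0, E2, F2, E1, F1.
  have k3 : (- h3 ^+ 2 != 0)%R by rewrite oppr_eq0 expf_neq0// kap3_neq0.
  rewrite /s e4 f4 e3 f3 (Ascale_eq0 k3 E0) (Ascale_eq0 k3 E2) (Ascale_eq0 k3 F2).
  by rewrite (Ascale_inj kap13 E1) (Ascale_inj kap13 F1).
(* K = 4: the cubic element removes both half-integral levels, the quadratic one levels 0 and 2,
   where its eigenvalues differ from (del - 2)^2 by multiples of del - 1 and 2 del - 3. *)
- have := rigid_casimir3_even (casimir3_lev4 s); rewrite Et => c3.
  have [E1 F1 E3 F3] := casimir3_odd del (Grs t0r p1r q1r t2r u2r p3r q3r t4r u4r).
  rewrite c3 in E1 F1 E3 F3; cbn [p1 q1 p3 q3] in E1, F1, E3, F3.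
  have f1 := Ascale_eq0 kap1_neq0 (esym E1).
  have f3 := Ascale_eq0 kap3_neq0 (esym E3).
  have k1 : (- h1 != 0)%R by rewrite oppr_eq0 kap1_neq0.
  have k3 : (- h3 != 0)%R by rewrite oppr_eq0 kap3_neq0.
  have e1 := Ascale_eq0 k1 (esym F1).
  have e3 := Ascale_eq0 k3 (esym F3).
  have := rigid_casimir_lev (casimir_lev4 s); rewrite Et => c.
  have [E0 E2 F2 _ _] := casimirE del (Grs t0r p1r q1r t2r u2r p3r q3r t4r u4r).
  rewrite c in E0 E2 F2; cbn [Gscale t0 t2 u2] in E0, E2, F2.
  have k42 : ((del - 2) ^+ 2 != (del - 1) ^+ 2)%R.
    by rewrite -subr_eq0 (_ : _ - _ = - (2 * del - 3))%R ?oppr_eq0//; ring.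
  have k40 : ((del - 2) ^+ 2 != del ^+ 2)%R.
    rewrite -subr_eq0 (_ : _ - _ = - 4 * (del - 1))%R; last by ring.
    by rewrite mulf_neq0// oppr_eq0 pnatr_eq0.
  rewrite /s e4 f4 e3 f3 e1 f1 (Ascale_inj k40 E0) (Ascale_inj k42 E2).
  by rewrite (Ascale_inj k42 F2).
Qed.

Lemma rigid s : b s = s.
Proof. by rewrite {1}(lev_sum s) !rigid_add !rigid_level// -lev_sum. Qed.
End Rigidity.

(** * Recovery of the coefficients from the operator *)

Lemma coef_t0 s : t0 s = 1 *: (opgS s (Ssf (dcst A 1) Z Z Z)
  - opgS (Grs O O O O O O O O O)
      (Ssf (dcst A 1) Z Z Z)).
Proof.
case: s => [[? ? ? ?] [? ? ? ?] [? ? ? ?] [? ? ? ?] [? ? ? ?]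
  [? ? ? ?] [? ? ? ?] [? ? ? ?] [? ? ? ?]].
by ssf_ring.
Qed.
Lemma coef_p1 s : p1 s = 1 *: (opgS s (Ssf Z (dcst A 1) Z Z)
  - opgS (Grs (t0 s) O O O O O O O O)
      (Ssf Z (dcst A 1) Z Z)).
Proof.
case: s => [[? ? ? ?] [? ? ? ?] [? ? ? ?] [? ? ? ?] [? ? ? ?]
  [? ? ? ?] [? ? ? ?] [? ? ? ?] [? ? ? ?]].
by ssf_ring.
Qed.
Lemma coef_q1 s : q1 s = 1 *: (opgS s (Ssf Z Z (dcst A 1) Z)
  - opgS (Grs (t0 s) (p1 s) O O O O O O O)
      (Ssf Z Z (dcst A 1) Z)).
Proof.
case: s => [[? ? ? ?] [? ? ? ?] [? ? ? ?] [? ? ? ?] [? ? ? ?]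
  [? ? ? ?] [? ? ? ?] [? ? ? ?] [? ? ? ?]].
by ssf_ring.
Qed.
(** The sign comes from Dbar1 Dbar2 (xi1 xi2) = -1. *)
Lemma coef_u2 s : u2 s = (-1) *: (opgS s (Ssf Z Z Z (dcst A 1))
  - opgS (Grs (t0 s) (p1 s) (q1 s) O O O O O O)
      (Ssf Z Z Z (dcst A 1))).
Proof.
case: s => [[? ? ? ?] [? ? ? ?] [? ? ? ?] [? ? ? ?] [? ? ? ?]
  [? ? ? ?] [? ? ? ?] [? ? ? ?] [? ? ? ?]].
by ssf_ring.
Qed.
Lemma coef_t2 s : t2 s = 1 *: (opgS s (Ssf X Z Z Z)
  - opgS (Grs (t0 s) (p1 s) (q1 s) O (u2 s) O O O O)
      (Ssf X Z Z Z)).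
Proof.
case: s => [[? ? ? ?] [? ? ? ?] [? ? ? ?] [? ? ? ?] [? ? ? ?]
  [? ? ? ?] [? ? ? ?] [? ? ? ?] [? ? ? ?]].
by ssf_ring.
Qed.
Lemma coef_p3 s : p3 s = 1 *: (opgS s (Ssf Z X Z Z)
  - opgS (Grs (t0 s) (p1 s) (q1 s) (t2 s) (u2 s) O O O O)
      (Ssf Z X Z Z)).
Proof.
case: s => [[? ? ? ?] [? ? ? ?] [? ? ? ?] [? ? ? ?] [? ? ? ?]
  [? ? ? ?] [? ? ? ?] [? ? ? ?] [? ? ? ?]].
by ssf_ring.
Qed.
Lemma coef_q3 s : q3 s = 1 *: (opgS s (Ssf Z Z X Z)
  - opgS (Grs (t0 s) (p1 s) (q1 s) (t2 s) (u2 s) (p3 s) O O O)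
      (Ssf Z Z X Z)).
Proof.
case: s => [[? ? ? ?] [? ? ? ?] [? ? ? ?] [? ? ? ?] [? ? ? ?]
  [? ? ? ?] [? ? ? ?] [? ? ? ?] [? ? ? ?]].
by ssf_ring.
Qed.
Lemma coef_u4 s : u4 s = (-1) *: (opgS s (Ssf Z Z Z X)
  - opgS (Grs (t0 s) (p1 s) (q1 s) (t2 s) (u2 s) (p3 s) (q3 s) O O)
      (Ssf Z Z Z X)).
Proof.
case: s => [[? ? ? ?] [? ? ? ?] [? ? ? ?] [? ? ? ?] [? ? ? ?]
  [? ? ? ?] [? ? ? ?] [? ? ? ?] [? ? ? ?]].
by ssf_ring.
Qed.
Lemma coef_t4 s : t4 s = half *: (opgS s (Ssf (X *' X) Z Z Z)
  - opgS (Grs (t0 s) (p1 s) (q1 s) (t2 s) (u2 s) (p3 s) (q3 s) O (u4 s))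
      (Ssf (X *' X) Z Z Z)).
Proof.
case: s => [[? ? ? ?] [? ? ? ?] [? ? ? ?] [? ? ? ?] [? ? ? ?]
  [? ? ? ?] [? ? ? ?] [? ? ? ?] [? ? ? ?]].
by ssf_ring.
Qed.

(** Applied to 1, xi1, xi2, xi1 xi2, x, x xi1, x xi2, x xi1 xi2 and x^2 in this order, an operator
    reveals its coefficients one by one, each after subtraction of the preceding ones. *)
Lemma opgS_inj s r : (forall g, opgS s g = opgS r g) -> s = r.
Proof.
move=> e.
have e_t0 : t0 s = t0 r by rewrite coef_t0 (coef_t0 r) e.
have e_p1 : p1 s = p1 r by rewrite coef_p1 (coef_p1 r) e e_t0.
have e_q1 : q1 s = q1 r by rewrite coef_q1 (coef_q1 r) e e_t0 e_p1.
have e_u2 : u2 s = u2 r by rewrite coef_u2 (coef_u2 r) e e_t0 e_p1 e_q1.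
have e_t2 : t2 s = t2 r by rewrite coef_t2 (coef_t2 r) e e_t0 e_p1 e_q1 e_u2.
have e_p3 : p3 s = p3 r by rewrite coef_p3 (coef_p3 r) e e_t0 e_p1 e_q1 e_u2 e_t2.
have e_q3 : q3 s = q3 r by rewrite coef_q3 (coef_q3 r) e e_t0 e_p1 e_q1 e_u2 e_t2 e_p3.
have e_u4 : u4 s = u4 r by rewrite coef_u4 (coef_u4 r) e e_t0 e_p1 e_q1 e_u2 e_t2 e_p3 e_q3.
have e_t4 : t4 s = t4 r by rewrite coef_t4 (coef_t4 r) e e_t0 e_p1 e_q1 e_u2 e_t2 e_p3 e_q3 e_u4.
by case: s r {e} e_t0 e_p1 e_q1 e_t2 e_u2 e_p3 e_q3 e_t4 e_u4
  => [? ? ? ? ? ? ? ? ?] [? ? ? ? ? ? ? ? ?] /= -> -> -> -> -> -> -> -> ->.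
Qed.

Lemma opgS_lin k h s r g :
  opgS (Gadd (Gscale k s) (Gscale h r)) g = k *: opgS s g + h *: opgS r g.
Proof.
rewrite /opgS; move: (AD1 (AD2 g)) (AD1 g) (AD2 g) => [? ? ? ?] [? ? ? ?] [? ? ? ?].
case: g => ? ? ? ?.
case: s => [[? ? ? ?] [? ? ? ?] [? ? ? ?] [? ? ? ?] [? ? ? ?]
  [? ? ? ?] [? ? ? ?] [? ? ? ?] [? ? ? ?]].
case: r => [[? ? ? ?] [? ? ? ?] [? ? ? ?] [? ? ? ?] [? ? ? ?]
  [? ? ? ?] [? ? ? ?] [? ? ? ?] [? ? ? ?]].
by ssf_ring.
Qed.

(** The terms follow the order of the nested sums over l, m, n in [Dsum], so that unfolded sums
    match syntactically. *)
Lemma opgS_sum s g : opgS s g =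
  t0 s * g + (q1 s * AD2 g + (p1 s * AD1 g + (u2 s * AD1 (AD2 g)
  + (t2 s * Adx g + (q3 s * Adx (AD2 g) + (p3 s * Adx (AD1 g)
  + (u4 s * Adx (AD1 (AD2 g)) + t4 s * Adx (Adx g)))))))).
Proof.
rewrite /opgS; do 9!move: (_ * _).
by move=> *; ssf_ring.
Qed.
(* The coefficient of the explicit quantization from [dx^l Dbar1^m Dbar2^n] in level
   [K] to [(l', m', n')]; the derivative applied to the symbol is dx^j Dbar1^a Dbar2^b
   with a = m (+) m', b = n (+) n', followed by the parity operator if a (+) b. *)
Definition qc (lam del : F) (K : nat) (m n : bool) (l' : nat) (m' n' : bool) : F :=
  match K, m, n, l', m', n' with
  | 0, false, false, 0, false, false => (1)%R
  | 1, false, true, 0, false, false => (lam * c0 del)%R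
  | 1, true, false, 0, false, false => (lam * c0 del)%R
  | 1, true, false, 0, true, false => (1)%R
  | 1, false, true, 0, false, true => (1)%R
  | 2, false, false, 0, false, false => (- (lam * c1 del))%R
  | 2, true, true, 0, false, false => (lam * (2 * lam + 1) * c12 del)%R
  | 2, false, false, 0, true, false => (- (1 / 2 * c1 del))%R
  | 2, true, true, 0, true, false => (- ((lam + 1 / 2) * c1 del))%R
  | 2, false, false, 0, false, true => (- (1 / 2 * c1 del))%R
  | 2, true, true, 0, false, true => ((lam + 1 / 2) * c1 del)%R
  | 2, false, false, 1, false, false => (1)%R
  | 2, true, true, 0, true, true => (1)%R
  | 3, false, true, 0, false, false => (- (lam * (2 * lam + 1) / 2 * c1 del ^+ 2))%R
  | 3, true, false, 0, false, false => (- (lam * (2 * lam + 1) / 2 * c1 del ^+ 2))%R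
  | 3, false, true, 0, true, false => ((2 * lam + 1) / 4 * c1 del ^+ 2)%R
  | 3, true, false, 0, true, false => ((2 * lam + 1) / 4 * c1 del ^+ 2 * (1 - 2 * del))%R
  | 3, false, true, 0, false, true => ((2 * lam + 1) / 4 * c1 del ^+ 2 * (1 - 2 * del))%R
  | 3, true, false, 0, false, true => (- ((2 * lam + 1) / 4 * c1 del ^+ 2))%R
  | 3, false, true, 1, false, false => ((lam + 1 / 2) * c1 del)%R
  | 3, true, false, 1, false, false => ((lam + 1 / 2) * c1 del)%R
  | 3, false, true, 0, true, true => (- (1 / 2 * c1 del))%R
  | 3, true, false, 0, true, true => (1 / 2 * c1 del)%R
  | 3, true, false, 1, true, false => (1)%R
  | 3, false, true, 1, false, true => (1)%R
  | 4, false, false, 0, false, false => (lam * (2 * lam + 1) * c23 del)%R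
  | 4, true, true, 0, false, false => (- (lam * (2 * lam + 1) * (lam + 1) * c1 del * c23 del))%R
  | 4, false, false, 0, true, false => ((2 * lam + 1) * c23 del)%R
  | 4, true, true, 0, true, false => ((2 * lam + 1) * (lam + 1) * c23 del)%R
  | 4, false, false, 0, false, true => ((2 * lam + 1) * c23 del)%R
  | 4, true, true, 0, false, true => (- ((2 * lam + 1) * (lam + 1) * c23 del))%R
  | 4, false, false, 1, false, false => (- ((2 * lam + 1) * c2 del))%R
  | 4, true, true, 1, false, false => ((lam + 1) * (2 * lam + 1) * c23 del)%R
  | 4, false, false, 0, true, true => (- c23 del)%R
  | 4, true, true, 0, true, true => (- ((lam + 1) * c2 del))%R
  | 4, false, false, 1, true, false => (- c2 del)%R
  | 4, true, true, 1, true, false => (- ((lam + 1) * c2 del))%R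
  | 4, false, false, 1, false, true => (- c2 del)%R
  | 4, true, true, 1, false, true => ((lam + 1) * c2 del)%R
  | 4, false, false, 2, false, false => (1)%R
  | 4, true, true, 1, true, true => (1)%R
  | _, _, _, _, _, _ => 0
  end.

(** * The explicit map as differential expressions, level by level *)

Definition monoS l (m n : bool) g : ssf :=
  iter l Adx ((if m then AD1 else id) ((if n then AD2 else id) g)).

Definition TS k l (m n : bool) a : ssf :=
  k *: (if m (+) n then Apar (monoS l m n a) else monoS l m n a).

(** The five expansions have the shape required by [diffexpr]: one term for each valid (m, n), in
    summation order, with coefficient 0 where nothing contributes. *)
Lemma q0_lev0 lam del s : q0 lam del (lev 0 s) =
  Grs (TS (1)%R 0 false false (t0 s))
    O
    O
    O
    O
    O
    O
    O
    O.
Proof.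
case: s => *; rewrite /q0 /=; congr Grs; try by []; rewrite /TS /monoS /=; by ssf_ring.
Qed.

Lemma q0_lev1 lam del s : q0 lam del (lev 1 s) =
  Grs (TS (lam * c0 del)%R 0 false true (q1 s)
      + TS (lam * c0 del)%R 0 true false (p1 s))
    (TS (0)%R 0 true true (q1 s)
      + TS (1)%R 0 false false (p1 s))
    (TS (1)%R 0 false false (q1 s)
      + TS (0)%R 0 true true (p1 s))
    O
    O
    O
    O
    O
    O.
Proof.
case: s => *; rewrite /q0 /=; congr Grs; try by []; rewrite /TS /monoS /=; by ssf_ring.
Qed.

Lemma q0_lev2 lam del s : q0 lam del (lev 2 s) =
  Grs (TS (- (lam * c1 del))%R 1 false false (t2 s)
      + TS (lam * (2 * lam + 1) * c12 del)%R 0 true true (u2 s))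
    (TS (- (1 / 2 * c1 del))%R 0 true false (t2 s)
      + TS (- ((lam + 1 / 2) * c1 del))%R 0 false true (u2 s))
    (TS (- (1 / 2 * c1 del))%R 0 false true (t2 s)
      + TS ((lam + 1 / 2) * c1 del)%R 0 true false (u2 s))
    (TS (1)%R 0 false false (t2 s)
      + TS (0)%R 0 true true (u2 s))
    (TS (0)%R 0 true true (t2 s)
      + TS (1)%R 0 false false (u2 s))
    O
    O
    O
    O.
Proof.
case: s => *; rewrite /q0 /=; congr Grs; try by []; rewrite /TS /monoS /=; by ssf_ring.
Qed.

Lemma q0_lev3 lam del s : q0 lam del (lev 3 s) =
  Grs (TS (- (lam * (2 * lam + 1) / 2 * c1 del ^+ 2))%R 1 false true (q3 s)
      + TS (- (lam * (2 * lam + 1) / 2 * c1 del ^+ 2))%R 1 true false (p3 s))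
    (TS ((2 * lam + 1) / 4 * c1 del ^+ 2)%R 0 true true (q3 s)
      + TS ((2 * lam + 1) / 4 * c1 del ^+ 2 * (1 - 2 * del))%R 1 false false (p3 s))
    (TS ((2 * lam + 1) / 4 * c1 del ^+ 2 * (1 - 2 * del))%R 1 false false (q3 s)
      + TS (- ((2 * lam + 1) / 4 * c1 del ^+ 2))%R 0 true true (p3 s))
    (TS ((lam + 1 / 2) * c1 del)%R 0 false true (q3 s)
      + TS ((lam + 1 / 2) * c1 del)%R 0 true false (p3 s))
    (TS (- (1 / 2 * c1 del))%R 0 true false (q3 s)
      + TS (1 / 2 * c1 del)%R 0 false true (p3 s))
    (TS (0)%R 0 true true (q3 s)
      + TS (1)%R 0 false false (p3 s))
    (TS (1)%R 0 false false (q3 s)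
      + TS (0)%R 0 true true (p3 s))
    O
    O.
Proof.
case: s => *; rewrite /q0 /=; congr Grs; try by []; rewrite /TS /monoS /=; by ssf_ring.
Qed.

Lemma q0_lev4 lam del s : q0 lam del (lev 4 s) =
  Grs (TS (lam * (2 * lam + 1) * c23 del)%R 2 false false (t4 s)
      + TS (- (lam * (2 * lam + 1) * (lam + 1) * c1 del * c23 del))%R 1 true true (u4 s))
    (TS ((2 * lam + 1) * c23 del)%R 1 true false (t4 s)
      + TS ((2 * lam + 1) * (lam + 1) * c23 del)%R 1 false true (u4 s))
    (TS ((2 * lam + 1) * c23 del)%R 1 false true (t4 s)
      + TS (- ((2 * lam + 1) * (lam + 1) * c23 del))%R 1 true false (u4 s))
    (TS (- ((2 * lam + 1) * c2 del))%R 1 false false (t4 s)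
      + TS ((lam + 1) * (2 * lam + 1) * c23 del)%R 0 true true (u4 s))
    (TS (- c23 del)%R 0 true true (t4 s)
      + TS (- ((lam + 1) * c2 del))%R 1 false false (u4 s))
    (TS (- c2 del)%R 0 true false (t4 s)
      + TS (- ((lam + 1) * c2 del))%R 0 false true (u4 s))
    (TS (- c2 del)%R 0 false true (t4 s)
      + TS ((lam + 1) * c2 del)%R 0 true false (u4 s))
    (TS (1)%R 0 false false (t4 s)
      + TS (0)%R 0 true true (u4 s))
    (TS (0)%R 0 true true (t4 s)
      + TS (1)%R 0 false false (u4 s)).
Proof.
case: s => *; rewrite /q0 /=; congr Grs; try by []; rewrite /TS /monoS /=; by ssf_ring.
Qed.

(* The parity operator is (1 - 2 xi1 Dbar1) (1 - 2 xi2 Dbar2), hence a differential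
   operator. *)
Lemma Apar_D1 l a : (l <= 2)%N ->
  Apar (monoS l true false a) =
  Ssf (dcst A 1) Z Z Z * monoS l true false a
  + (Ssf Z Z (dcst A 2) Z * monoS l true true a
  + (Ssf Z (dcst A 2) Z Z * monoS l.+1 false false a
  + Ssf Z Z Z (dcst A (- 4)%R) * monoS l.+1 false true a)).
Proof. by case: a => ? ? ? ?; case: l => [|[|[|//]]] _; ssf_ring. Qed.

Lemma Apar_D2 l a : (l <= 2)%N ->
  Apar (monoS l false true a) =
  Ssf (dcst A 1) Z Z Z * monoS l false true a
  + (Ssf Z (dcst A (- 2)%R) Z Z * monoS l true true a
  + (Ssf Z Z (dcst A 2) Z * monoS l.+1 false false a
  + Ssf Z Z Z (dcst A 4) * monoS l.+1 true false a)).
Proof. by case: a => ? ? ? ?; case: l => [|[|[|//]]] _; ssf_ring. Qed.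

Lemma Amul_scale k a b : (k *: a) * b = k *: (a * b).
Proof. by ssf_ring. Qed.
Lemma A1mul a : Ssf (dcst A 1) Z Z Z * a = a.
Proof. by ssf_ring. Qed.
Lemma AscaleD k a b : k *: (a + b) = k *: a + k *: b.
Proof. by ssf_ring. Qed.
End Super.
End Super.

From mathcomp Require Import all_classical all_reals all_analysis.
From mathcomp Require Import complex.
Import Super.

(** * Smooth functions *)

Section Smooth.
Variable R : realType.
Implicit Types f g : R -> R[i].

Definition cdiff f : Prop := forall x : R,
  derivable (fun t => complex.Re (f t)) x 1 /\ derivable (fun t => complex.Im (f t)) x 1.

Lemma cderE f x : cder f x = Complex ('D_1 (fun t => complex.Re (f t)) x)
                                     ('D_1 (fun t => complex.Im (f t)) x).
Proof. by rewrite /cder !derive1E. Qed.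

Lemma ReD (a b : R[i]) : complex.Re (a + b) = complex.Re a + complex.Re b.
Proof. by case: a; case: b. Qed.
Lemma ImD (a b : R[i]) : complex.Im (a + b) = complex.Im a + complex.Im b.
Proof. by case: a; case: b. Qed.
Lemma ReM (a b : R[i]) : complex.Re (a * b) =
  complex.Re a * complex.Re b - complex.Im a * complex.Im b.
Proof. by case: a; case: b. Qed.
Lemma ImM (a b : R[i]) : complex.Im (a * b) =
  complex.Re a * complex.Im b + complex.Im a * complex.Re b.
Proof. by case: a; case: b. Qed.

(** Restated for explicit pointwise functions, the form in which real and imaginary parts appear. *)
Lemma D1D (u v : R -> R) x : derivable u x 1 -> derivable v x 1 ->
  'D_1 (fun t => u t + v t) x = 'D_1 u x + 'D_1 v x.
Proof. exact: deriveD. Qed.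

Lemma D1B (u v : R -> R) x : derivable u x 1 -> derivable v x 1 ->
  'D_1 (fun t => u t - v t) x = 'D_1 u x - 'D_1 v x.
Proof. exact: deriveB. Qed.

Lemma D1M (u v : R -> R) x : derivable u x 1 -> derivable v x 1 ->
  'D_1 (fun t => u t * v t) x = u x * 'D_1 v x + v x * 'D_1 u x.
Proof. exact: deriveM. Qed.

Lemma derivable1M (u v : R -> R) x : derivable u x 1 -> derivable v x 1 ->
  derivable (fun t => u t * v t) x 1.
Proof. exact: derivableM. Qed.

Lemma derivable1D (u v : R -> R) x : derivable u x 1 -> derivable v x 1 ->
  derivable (fun t => u t + v t) x 1.
Proof. exact: derivableD. Qed.

Lemma derivable1B (u v : R -> R) x : derivable u x 1 -> derivable v x 1 ->
  derivable (fun t => u t - v t) x 1.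
Proof. exact: derivableB. Qed.

Lemma cdiffD f g : cdiff f -> cdiff g -> cdiff (fun x => f x + g x).
Proof.
move=> hf hg x; have [f1 f2] := hf x; have [g1 g2] := hg x; split.
  by under eq_fun do rewrite ReD; exact: derivable1D f1 g1.
by under eq_fun do rewrite ImD; exact: derivable1D f2 g2.
Qed.

Lemma cderD f g : cdiff f -> cdiff g ->
  cder (fun x => f x + g x) = (fun x => cder f x + cder g x).
Proof.
move=> hf hg; apply: funext => x; have [f1 f2] := hf x; have [g1 g2] := hg x.
rewrite !cderE; under eq_fun do rewrite ReD.
under [X in Complex _ ('D_1 X x)]eq_fun do rewrite ImD.
by rewrite (D1D f1 g1) (D1D f2 g2).
Qed.

Lemma cdiffM f g : cdiff f -> cdiff g -> cdiff (fun x => f x * g x).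
Proof.
move=> hf hg x; have [f1 f2] := hf x; have [g1 g2] := hg x; split.
  under eq_fun do rewrite ReM.
  exact: derivable1B (derivable1M f1 g1) (derivable1M f2 g2).
under eq_fun do rewrite ImM.
exact: derivable1D (derivable1M f1 g2) (derivable1M f2 g1).
Qed.

Lemma cderM f g : cdiff f -> cdiff g ->
  cder (fun x => f x * g x) = (fun x => cder f x * g x + f x * cder g x).
Proof.
move=> hf hg; apply: funext => x; have [f1 f2] := hf x; have [g1 g2] := hg x.
rewrite !cderE; under eq_fun do rewrite ReM.
under [X in Complex _ ('D_1 X x)]eq_fun do rewrite ImM.
rewrite (D1B (derivable1M f1 g1) (derivable1M f2 g2)).
rewrite (D1D (derivable1M f1 g2) (derivable1M f2 g1)).
rewrite (D1M f1 g1) (D1M f2 g2) (D1M f1 g2) (D1M f2 g1).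
move: ('D_1 _ x) ('D_1 _ x) ('D_1 _ x) ('D_1 _ x) => f1' f2' g1' g2'.
case: (f x) => a b; case: (g x) => c e.
by apply/eqP; rewrite eq_complex /=; apply/andP; split; apply/eqP; ring.
Qed.

Lemma cdiff_cst (c : R[i]) : cdiff (fun=> c).
Proof. by move=> x; split; exact: derivable_cst. Qed.

Lemma cder_cst (c : R[i]) : cder (fun=> c) = (fun _ : R => 0).
Proof. by apply: funext => x; rewrite cderE !derive_cst. Qed.

Lemma cdiff_xC : cdiff (@xC R).
Proof. by move=> x; split; [exact: derivable_id|exact: derivable_cst]. Qed.

Lemma cder_xC : cder (@xC R) = (fun=> 1).
Proof. by apply: funext => x; rewrite cderE /= derive_id derive_cst. Qed.

(** A bounded order makes induction on the Leibniz rule possible: in f'g + fg' the derivatives have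
    one order less, and the other factors are weakened to it. *)
Definition ndiff n f := forall k, (k <= n)%N -> cdiff (iter k (@cder R) f).

Lemma ndiffS n f : ndiff n.+1 f <-> cdiff f /\ ndiff n (cder f).
Proof.
split=> [h|[h0 h] [|k] kn].
- by split=> [|k kn]; [exact: (h 0%N)|have := h k.+1 kn; rewrite iterSr].
- exact: h0.
- by rewrite iterSr; apply: h.
Qed.

Lemma csmoothP f : csmooth f <-> forall n, ndiff n f.
Proof. by split=> [h n k _ x|h n x]; [exact: h|exact: (h n n)]. Qed.

Lemma ndiff_le n f : ndiff n.+1 f -> ndiff n f.
Proof. by move=> h k kn; apply: h; exact: leqW. Qed.

Lemma ndiffD n f g : ndiff n f -> ndiff n g -> ndiff n (fun x => f x + g x).
Proof.
elim: n f g => [|n IH] f g hf hg.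
  by move=> [|//] _; apply: cdiffD; [exact: (hf 0%N)|exact: (hg 0%N)].
move/ndiffS: hf => [f0 f1]; move/ndiffS: hg => [g0 g1].
by apply/ndiffS; split; [exact: cdiffD|rewrite (cderD f0 g0); exact: IH].
Qed.

Lemma ndiffM n f g : ndiff n f -> ndiff n g -> ndiff n (fun x => f x * g x).
Proof.
elim: n f g => [|n IH] f g hf hg.
  by move=> [|//] _; apply: cdiffM; [exact: (hf 0%N)|exact: (hg 0%N)].
have [f0 f1] := (ndiffS n f).1 hf; have [g0 g1] := (ndiffS n g).1 hg.
apply/ndiffS; split; first exact: cdiffM.
rewrite (cderM f0 g0); apply: ndiffD.
  exact: IH f1 (ndiff_le hg).
exact: IH (ndiff_le hf) g1.
Qed.

Lemma csmooth_cdiff f : csmooth f -> cdiff f.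
Proof. by move=> h x; exact: (h 0%N x). Qed.

Lemma csmoothD f g : csmooth f -> csmooth g -> csmooth (fun x => f x + g x).
Proof. by move=> /csmoothP hf /csmoothP hg; apply/csmoothP => n; exact: ndiffD. Qed.

Lemma csmoothM f g : csmooth f -> csmooth g -> csmooth (fun x => f x * g x).
Proof. by move=> /csmoothP hf /csmoothP hg; apply/csmoothP => n; exact: ndiffM. Qed.

Lemma csmooth_der f : csmooth f -> csmooth (cder f).
Proof. by move=> h n x; have := h n.+1 x; rewrite iterSr. Qed.

Lemma csmooth_cst (c : R[i]) : csmooth (fun _ : R => c).
Proof.
apply/csmoothP; move=> n; elim: n c => [|n IH] c.
  by move=> [|//] _; exact: cdiff_cst.
by apply/ndiffS; split; [exact: cdiff_cst|rewrite cder_cst].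
Qed.

Lemma csmooth_xC : csmooth (@xC R).
Proof.
apply/csmoothP => -[|n]; first by move=> [|//] _; exact: cdiff_xC.
apply/ndiffS; split; first exact: cdiff_xC.
by rewrite cder_xC; move/csmoothP: (csmooth_cst 1).
Qed.

Lemma csmoothN f : csmooth f -> csmooth (fun x => - f x).
Proof.
move=> h; rewrite (_ : (fun x => - f x) = (fun x => -1 * f x)); last first.
  by apply: funext => x; rewrite mulN1r.
exact: csmoothM (csmooth_cst _) h.
Qed.

Lemma cderN f : cdiff f -> cder (fun x => - f x) = (fun x => - cder f x).
Proof.
move=> h; rewrite (_ : (fun x => - f x) = (fun x => -1 * f x)); last first.
  by apply: funext => x; rewrite mulN1r.
rewrite (cderM (cdiff_cst _) h).
by apply: funext => x; rewrite cder_cst mul0r add0r mulN1r.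
Qed.

Record smf := Smf { sf :> R -> R[i]; sfP : csmooth sf }.

Lemma smf_ext (f g : smf) : (forall x, f x = g x) -> f = g.
Proof.
case: f g => f hf [g hg] /= /funext e; subst g.
by rewrite (Prop_irrelevance hf hg).
Qed.

Definition addf (f g : smf) := Smf (csmoothD (sfP f) (sfP g)).
Definition mulf (f g : smf) := Smf (csmoothM (sfP f) (sfP g)).
Definition oppf (f : smf) := Smf (csmoothN (sfP f)).
Definition derf (f : smf) := Smf (csmooth_der (sfP f)).
Definition cstf (c : R[i]) := Smf (csmooth_cst c).
Definition xf := Smf csmooth_xC.

Implicit Types u v w : smf.

Lemma derfD u v : derf (addf u v) = addf (derf u) (derf v).
Proof.
apply: smf_ext => x /=.
by rewrite (cderD (csmooth_cdiff (sfP u)) (csmooth_cdiff (sfP v))).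
Qed.
Lemma derfM u v : derf (mulf u v) = addf (mulf (derf u) v) (mulf u (derf v)).
Proof.
apply: smf_ext => x /=.
by rewrite (cderM (csmooth_cdiff (sfP u)) (csmooth_cdiff (sfP v))).
Qed.
Lemma derfN u : derf (oppf u) = oppf (derf u).
Proof. by apply: smf_ext => x /=; rewrite (cderN (csmooth_cdiff (sfP u))). Qed.
Lemma derf_cst c : derf (cstf c) = cstf 0.
Proof. by apply: smf_ext => x /=; rewrite cder_cst. Qed.
Lemma derf_x : derf xf = cstf 1.
Proof. by apply: smf_ext => x /=; rewrite cder_xC. Qed.

Definition smooth_dalg : dalg R[i] := @DAlg R[i] R smf sf addf mulf oppf cstf derf xf
  smf_ext (fun _ _ _ => erefl) (fun _ _ _ => erefl) (fun _ _ => erefl)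
  (fun _ _ => erefl) derfD derfM derfN derf_cst derf_x.
End Smooth.

(** * Differential operators on the supercircle *)

Section Operators.
Variable R : realType.
Local Notation A := (smooth_dalg R).
Local Notation ssf := (ssf A).
Local Notation grs := (grs A).
Local Notation Gzero :=
  (Grs (Azero A) (Azero A) (Azero A) (Azero A) (Azero A) (Azero A) (Azero A)
    (Azero A) (Azero A)).
Implicit Types (a b c : ssf) (s r : grs) (lam mu del : R[i]).

(* Locked: otherwise matching [emb _] against an arbitrary superfunction unfolds
   everything down to derivatives. *)
Definition emb : ssf -> Defs.sfun R := locked (fun a =>
  SFun (a0 a : smf R) (a1 a : smf R) (a2 a : smf R) (a3 a : smf R)).

Lemma emb_unlock a :
  emb a = SFun (a0 a : smf R) (a1 a : smf R) (a2 a : smf R) (a3 a : smf R).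
Proof. by rewrite /emb -lock. Qed.

Lemma sfun_ext (f g : Defs.sfun R) : (forall x, s0 f x = s0 g x) ->
  (forall x, s1 f x = s1 g x) -> (forall x, s2 f x = s2 g x) ->
  (forall x, s12 f x = s12 g x) -> f = g.
Proof.
by case: f g => [? ? ? ?] [? ? ? ?] /= /funext -> /funext -> /funext -> /funext ->.
Qed.

Lemma emb_inj : injective emb.
Proof.
move=> a b; rewrite !emb_unlock => -[h0 h1 h2 h3]; apply: ssf_ext => x;
  [move: h0|move: h1|move: h2|move: h3] => /(congr1 (@^~ x)); exact.
Qed.

Lemma embD1 a : sD1 (emb a) = emb (AD1 a).
Proof. by rewrite !emb_unlock; apply: sfun_ext => x /=; rewrite ?oppr0 ?addr0 ?add0r. Qed.
Lemma embD2 a : sD2 (emb a) = emb (AD2 a).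
Proof. by rewrite !emb_unlock; apply: sfun_ext => x /=; rewrite ?opprK ?oppr0 ?addr0 ?add0r. Qed.
Lemma embadd a b : sadd (emb a) (emb b) = emb (Aadd a b).
Proof. by rewrite !emb_unlock. Qed.
Lemma embopp a : sopp (emb a) = emb (Aopp a).
Proof. by rewrite !emb_unlock. Qed.
Lemma embscale k a : sscale k (emb a) = emb (Ascale k a).
Proof. by rewrite !emb_unlock. Qed.
Lemma embmul a b : smul (emb a) (emb b) = emb (Amul a b).
Proof. by rewrite !emb_unlock. Qed.
Lemma embdx a : sdx (emb a) = emb (Adx a).
Proof. by rewrite !emb_unlock. Qed.
Lemma embev a : sev (emb a) = emb (Aev a).
Proof. by rewrite !emb_unlock. Qed.
Lemma embod a : sod (emb a) = emb (Aod a).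
Proof. by rewrite !emb_unlock. Qed.
Lemma embzero : szero R = emb (Azero A).
Proof. by rewrite !emb_unlock. Qed.

Definition embE := (embD1, embD2, embadd, embopp, embscale, embmul, embdx, embev, embod).

Lemma gen_funE X : gen_fun R X = emb (genS A X).
Proof. by rewrite emb_unlock; case: X. Qed.

Lemma Lgen_emb h X a : Lgen h X (emb a) = emb (LS h X a).
Proof. by rewrite /Lgen /Lact /Xcontact gen_funE !embE LSE. Qed.

Lemma ssmooth_emb a : ssmooth (emb a).
Proof. by rewrite emb_unlock; split; [exact: sfP|split; [exact: sfP|split; exact: sfP]]. Qed.

(** The default value 0 makes the map total; on smooth functions it inverts the inclusion. *)
Definition to_smf (f : R -> R[i]) : smf R :=
  if pselect (csmooth f) is left h then Smf h else cstf 0.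

Lemma to_smfK f : csmooth f -> to_smf f = f :> (R -> R[i]).
Proof. by rewrite /to_smf; case: pselect. Qed.

Lemma sf_to_smf (u : smf R) : to_smf u = u.
Proof. by apply: smf_ext => x; rewrite to_smfK//; exact: sfP. Qed.

Definition to_ssf (f : Defs.sfun R) : ssf :=
  @Ssf _ A (to_smf (s0 f)) (to_smf (s1 f)) (to_smf (s2 f)) (to_smf (s12 f)).

Lemma to_ssfK f : ssmooth f -> emb (to_ssf f) = f.
Proof.
by move=> [h0 [h1 [h2 h3]]]; rewrite emb_unlock; apply: sfun_ext => x /=; rewrite to_smfK.
Qed.

Lemma embK a : to_ssf (emb a) = a.
Proof. by rewrite emb_unlock; case: a => *; rewrite /to_ssf /= !sf_to_smf. Qed.

(** * Symbols and operators in terms of coefficient vectors *)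

Definition to_gr s : grT R := fun K m n =>
  match K, m, n with
  | 0, false, false => emb (t0 s)
  | 1, true, false => emb (p1 s) | 1, false, true => emb (q1 s)
  | 2, false, false => emb (t2 s) | 2, true, true => emb (u2 s)
  | 3, true, false => emb (p3 s) | 3, false, true => emb (q3 s)
  | 4, false, false => emb (t4 s) | 4, true, true => emb (u4 s)
  | _, _, _ => szero R
  end.

Definition of_gr (sg : grT R) : grs :=
  Grs (to_ssf (sg 0 false false)) (to_ssf (sg 1 true false)) (to_ssf (sg 1 false true))
    (to_ssf (sg 2 false false)) (to_ssf (sg 2 true true))
    (to_ssf (sg 3 true false)) (to_ssf (sg 3 false true))
    (to_ssf (sg 4 false false)) (to_ssf (sg 4 true true)).

Lemma to_grK s : of_gr (to_gr s) = s.
Proof. by case: s => *; rewrite /of_gr /= !embK. Qed.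

Lemma graded_to_gr s : graded (to_gr s).
Proof. by move=> [|[|[|[|[|K]]]]] [] []; try exact: ssmooth_emb. Qed.

(** [graded] forces 0 outside the valid slots, which is what [to_gr] puts there. *)
Lemma of_grK sg : graded sg -> to_gr (of_gr sg) = sg.
Proof.
move=> h; apply: funext => K; apply: funext => m; apply: funext => n.
by move: (h K); case: K => [|[|[|[|[|K]]]]] /= /(_ m n);
  case: m; case: n => //= e; rewrite ?to_ssfK.
Qed.

Definition opg s : op R := fun g => emb (opgS s (to_ssf g)).

Lemma opgE s a : opg s (emb a) = emb (opgS s a).
Proof. by rewrite /opg embK. Qed.

Lemma opeqP (B C : op R) : opeq B C <-> forall a, B (emb a) = C (emb a).
Proof.
split=> [h a|h g /to_ssfK <-]; first exact/h/ssmooth_emb.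
exact: h.
Qed.

Lemma opg_inj s r : opeq (opg s) (opg r) -> s = r.
Proof.
by move=> /opeqP h; apply: opgS_inj => a; have := h a; rewrite !opgE => /emb_inj.
Qed.

Lemma Lop_emb lam mu X (B : op R) (B' : ssf -> ssf) :
  (forall a, B (emb a) = emb (B' a)) ->
  forall a, Lop lam mu X B (emb a) = emb (LopS lam mu X B' a).
Proof.
move=> hB a; rewrite /Lop /LopS /op_ev /op_od !Lgen_emb hB Lgen_emb.
case: (gen_odd X); last first.
  by rewrite hB embopp embadd.
by rewrite !(embev, embod) !hB !(embev, embod) !(embadd, embopp).
Qed.

Lemma Lop_opg lam mu X s :
  opeq (Lop lam mu X (opg s)) (opg (actD lam (mu - lam) X s)).
Proof.
apply/opeqP => a; rewrite opgE -LopSE addrC subrK.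
by rewrite (Lop_emb _ _ _ (opgE s)).
Qed.

(** Agreement on smooth arguments suffices because the action and the parity projections preserve
    smoothness. *)
Lemma Lop_eq lam mu X (B C : op R) : opeq B C -> opeq (Lop lam mu X B) (Lop lam mu X C).
Proof.
move=> /opeqP h; apply/opeqP => a.
by rewrite /Lop /op_ev /op_od !Lgen_emb !embev !embod !h.
Qed.
#[local] Arguments mono : simpl never.
#[local] Arguments monoS : simpl never.

Lemma emb_mono l m n a : mono l m n (emb a) = emb (monoS l m n a).
Proof.
rewrite /mono /monoS; elim: l => [|l IH] /=; last by rewrite IH embdx.
by case: m; case: n; rewrite /= ?embD2 ?embD1.
Qed.

Lemma opsym_lev K s : (K < 5)%N -> opeq (opsym K (to_gr s K)) (opg (lev K s)).
Proof.
move=> K5; apply/opeqP => a; rewrite opgE opgS_sum /opsym.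
case: s => *; case: K K5 => [|[|[|[|[|//]]]]] _; rewrite /bools /sbig unlock /=;
  rewrite !emb_mono embzero !embmul !embadd /monoS /=;
  rewrite !(Amul0, Aadd0, A0add) //; by rewrite AaddC.
Qed.

Definition coefs s l m n : Defs.sfun R := to_gr s (wt l m n) m n.

Lemma ssmooth_zero : ssmooth (szero R).
Proof. by rewrite embzero; exact: ssmooth_emb. Qed.

Lemma ssmooth_graded sg K m n : @graded R sg -> ssmooth (sg K m n).
Proof.
move=> /(_ K); case: ifP => _ h; last by rewrite h; exact: ssmooth_zero.
by move: (h m n); case: ifP => // _ ->; exact: ssmooth_zero.
Qed.

Lemma ssmooth_coefs s l m n : ssmooth (coefs s l m n).
Proof. exact: (@ssmooth_graded (to_gr s) _ _ _ (graded_to_gr s)). Qed.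

(** The two values of [K'] cover [Dlt] and [Dle], as [wt l m n <= K] is convertible to
    [wt l m n < K.+1]. *)
Lemma Dsum_opg K K' s : (K < 5)%N -> (K' = K \/ K' = K.+1) -> below K' s ->
  Dsum K.+1 (fun l m n => (wt l m n < K')%N) (opg s).
Proof.
move=> K5 hK hs; exists (coefs s); split; first exact: ssmooth_coefs.
have z0 (h : (K' <= 0)%N) : t0 s = Azero A.
  by have := hs _ h; rewrite lev0E => /(congr1 (@t0 _ _)).
have z1 (h : (K' <= 1)%N) : p1 s = Azero A /\ q1 s = Azero A.
  by have := hs _ h; rewrite lev1E => e; split;
    [exact: (congr1 (@p1 _ _) e)|exact: (congr1 (@q1 _ _) e)].
have z2 (h : (K' <= 2)%N) : t2 s = Azero A /\ u2 s = Azero A.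
  by have := hs _ h; rewrite lev2E => e; split;
    [exact: (congr1 (@t2 _ _) e)|exact: (congr1 (@u2 _ _) e)].
have z3 (h : (K' <= 3)%N) : p3 s = Azero A /\ q3 s = Azero A.
  by have := hs _ h; rewrite lev3E => e; split;
    [exact: (congr1 (@p3 _ _) e)|exact: (congr1 (@q3 _ _) e)].
have z4 (h : (K' <= 4)%N) : t4 s = Azero A /\ u4 s = Azero A.
  by have := hs _ h; rewrite lev4E => e; split;
    [exact: (congr1 (@t4 _ _) e)|exact: (congr1 (@u4 _ _) e)].
move=> g /to_ssfK <-; rewrite opgE opgS_sum; move: (to_ssf g) => a {g hs}.
move: z0 z1 z2 z3 z4; rewrite /coefs /bools.
case: K K5 hK => [|[|[|[|[|//]]]]] _ [] -> z0 z1 z2 z3 z4; rewrite /sbig unlock /=;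
  try rewrite (z0 isT); try (case: (z1 isT) => -> ->); try (case: (z2 isT) => -> ->);
  try (case: (z3 isT) => -> ->); try (case: (z4 isT) => -> ->);
  rewrite ?emb_mono ?embzero ?embmul !embadd !(Amul0, Aadd0, A0add) ?AaddA ?Aadd0 //.
Qed.
Lemma Dsum_ex K K' (B : op R) : (K < 5)%N -> (K' = K \/ K' = K.+1) ->
  Dsum K.+1 (fun l m n => (wt l m n < K')%N) B ->
  exists2 s, below K' s & opeq B (opg s).
Proof.
move=> K5 hK [f [fs hB]].
(* The family [f] is arbitrary at indices that the sum skips, so it is cut off there. *)
pose c l m n := if (wt l m n < K')%N then to_ssf (f l m n) else Azero A.
exists (Grs (c 0 false false) (c 0 true false) (c 0 false true) (c 1 false false)
  (c 0 true true) (c 1 true false) (c 1 false true) (c 2 false false) (c 1 true true))%N.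
  move: hK; rewrite /c; clear.
  by case: K => [|[|[|[|[|?]]]]] [] -> [|[|[|[|[|?]]]]].
have ce l m n a : smul (f l m n) (mono l m n (emb a)) =
    emb (Amul (to_ssf (f l m n)) (monoS l m n a)).
  by rewrite -embmul -emb_mono to_ssfK.
apply/opeqP => a; rewrite hB ?opgE ?opgS_sum; last exact: ssmooth_emb.
cbn [t0 p1 q1 t2 u2 p3 q3 t4 u4]; rewrite /c /bools; move: K5; clear hB.
by case: K hK => [|[|[|[|[|//]]]]] [] -> _; rewrite /sbig unlock /=;
  rewrite ?ce ?embzero !embadd !(Amul0, Aadd0, A0add) ?AaddA ?Aadd0.
Qed.

Lemma opeq_sym (B C : op R) : opeq B C -> opeq C B.
Proof. by move=> h g gs; rewrite h. Qed.

Lemma opeq_trans (B C D : op R) : opeq B C -> opeq C D -> opeq B D.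
Proof. by move=> h k g gs; rewrite h// k. Qed.

Lemma opsub_eq (B B' C C' : op R) :
  opeq B B' -> opeq C C' -> opeq (opsub B C) (opsub B' C').
Proof. by move=> h k g gs; rewrite /opsub h// k. Qed.

Lemma Dsum_eq N P (B C : op R) : opeq B C -> Dsum N P B -> Dsum N P C.
Proof. by move=> h [c [cs e]]; exists c; split=> // g gs; rewrite -h// e. Qed.

Lemma opsub_opg s r : opeq (opsub (opg s) (opg r)) (opg (Gadd s (Gscale (-1) r))).
Proof.
apply/opeqP => a; rewrite /opsub !opgE embopp embadd.
by rewrite -{2}(Gscale1 s) opgS_lin Ascale1 -AoppE.
Qed.

(** Coefficients are unique, so membership in the filtration can be read on them. *)
Lemma Dlt_sub_below K (B C : op R) s r : (K < 5)%N -> opeq B (opg s) -> opeq C (opg r) ->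
  Dlt K (opsub B C) <-> below K (Gadd s (Gscale (-1) r)).
Proof.
move=> K5 hB hC.
have e := opeq_trans (opsub_eq hB hC) (opsub_opg s r).
split=> h.
  have [d db he] := Dsum_ex K5 (or_introl erefl) h.
  by rewrite (opg_inj (opeq_trans (opeq_sym e) he)).
exact: (Dsum_eq (opeq_sym e) (Dsum_opg K5 (or_introl erefl) h)).
Qed.

(** On a level [K] symbol [actN] lands in lower levels, so [actG] alone survives in the quotient. *)
Lemma grrel_actG lam mu X s s' :
  grrel lam mu X (to_gr s) (to_gr s') <-> s' = actG (mu - lam) X s.
Proof.
have e K : (K < 5)%N -> Dlt K (opsub (Lop lam mu X (opsym K (to_gr s K)))
    (opsym K (to_gr s' K))) <->
    below K (Gadd (actD lam (mu - lam) X (lev K s)) (Gscale (-1) (lev K s'))).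
  move=> K5; apply: Dlt_sub_below => //; last exact: opsym_lev.
  exact: opeq_trans (Lop_eq _ _ _ (opsym_lev s K5)) (Lop_opg _ _ _ _).
split=> [[_ h]|es'].
  have h' K : (K < 5)%N -> lev K s' = lev K (actG (mu - lam) X s).
    move=> K5; have /(_ K (leqnn K)) := (e K K5).1 (h K K5).
    rewrite levD levZ => /Gsub_eq0; rewrite lev_idem => <-.
    by rewrite /actD levD (actN_below lam X s (leqnn K)) Gadd0 lev_actG lev_idem.
  by rewrite (lev_sum s') (lev_sum (actG _ _ _)) !h'.
split; first exact: graded_to_gr.
move=> K K5; apply: (e K K5).2 => K' KK'; rewrite es'.
rewrite levD levZ /actD levD (actN_below lam X s KK') Gadd0 lev_actG.
exact: Gsubb.
Qed.

Lemma to_gr_lin (k h : R[i]) s r :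
  gadd (gscale k (to_gr s)) (gscale h (to_gr r)) =
  to_gr (Gadd (Gscale k s) (Gscale h r)).
Proof.
apply: funext => K; apply: funext => m; apply: funext => n; rewrite /gadd /gscale.
by case: K m n => [|[|[|[|[|K]]]]] [] []; rewrite /= ?embzero !embscale !embadd //;
  rewrite !Ascale0 Aadd0.
Qed.

Lemma grinj_lev K s : (K < 5)%N -> grinj K (to_gr s K) = to_gr (lev K s).
Proof.
move=> K5; apply: funext => K'; rewrite /grinj.
apply: funext => m; apply: funext => n.
move: s => [? ? ? ? ? ? ? ? ?].
by case: K K5 => [|[|[|[|[|//]]]]] _; case: K' m n => [|[|[|[|[|K']]]]] [] [];
  rewrite /= ?embzero.
Qed.

Lemma sym_lev K f : (K < 5)%N -> sym K f -> exists s, f = to_gr s K.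
Proof.
move=> K5 fs; have g : graded (grinj K f).
  move=> K'; rewrite /grinj; case: eqP => [->|_]; first by rewrite K5.
  by case: ifP => // _ m n; case: ifP => // _; exact: ssmooth_zero.
exists (of_gr (grinj K f)); apply/esym.
by rewrite of_grK// /grinj eqxx.
Qed.

(** * Parity-twisted derivatives as differential operators *)

Definition spar (f : Defs.sfun R) : Defs.sfun R :=
  SFun (s0 f) (fun x => - s1 f x) (fun x => - s2 f x) (s12 f).

Lemma emb_par a : spar (emb a) = emb (Apar a).
Proof. by rewrite !emb_unlock. Qed.

Definition Tder k l (m n : bool) : op R := fun f =>
  sscale k (if m (+) n then spar (mono l m n f) else mono l m n f).

Lemma emb_T k l m n a : Tder k l m n (emb a) = emb (TS k l m n a).
Proof.
rewrite /Tder /TS emb_mono -embscale.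
by case: (m (+) n); rewrite ?emb_par.
Qed.

(** When exactly one of [m], [n] holds, these are the coefficients of [Apar_D1] or [Apar_D2] times
    [k]; otherwise a single monomial remains. *)
Definition Tcoefs k l (m n : bool) : nat -> bool -> bool -> Defs.sfun R :=
  let c (u : ssf) := emb (Ascale k u) in
  let z := cstf 0 : A in
  fun l' m' n' =>
  if l' == l then
    match m, n, m', n' with
    | true, true, true, true | true, false, true, false
    | false, true, false, true | false, false, false, false =>
        c (Ssf (dcst A 1) z z z)
    | true, false, true, true => c (Ssf z z (dcst A 2) z)
    | false, true, true, true => c (Ssf z (dcst A (- 2)) z z)
    | _, _, _, _ => szero R
    end
  else if l' == l.+1 then
    match m, n, m', n' with
    | true, false, false, false => c (Ssf z (dcst A 2) z z)
    | true, false, false, true => c (Ssf z z z (dcst A (- 4)))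
    | false, true, false, false => c (Ssf z z (dcst A 2) z)
    | false, true, true, false => c (Ssf z z z (dcst A 4))
    | _, _, _, _ => szero R
    end
  else szero R.

Lemma isdiffop_T k l m n : (l <= 2)%N -> isdiffop (Tder k l m n).
Proof.
(* 2l + 3 is the double weight of dx^(l+1) Dbar_i, the largest monomial of the expansions. *)
move=> l2; exists (2 * l + 3)%N, (Tcoefs k l m n); split.
  move=> l' m' n'; rewrite /Tcoefs; (case: eqP => _; last case: eqP => _);
    case: m n m' n' => [] [] [] [] /=;
    match goal with |- ssmooth (emb _) => exact: ssmooth_emb | _ => exact: ssmooth_zero end.
move=> g /to_ssfK <-; move: (to_ssf g) => a; rewrite emb_T /TS.
case: m n => [] [] /=; rewrite ?Apar_D1 ?Apar_D2//.
all: case: l l2 => [|[|[|//]]] _; rewrite /Tcoefs /bools /sbig unlock /=.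
all: rewrite ?emb_mono ?embzero ?embmul !embadd !(Amul0, Aadd0, A0add).
all: by rewrite !Amul_scale ?AscaleD ?A1mul ?AaddA.
Qed.

(** * The quantization map on symbols and its uniqueness *)

Section Quantization.
Variables lam mu : R[i].
Local Notation del := (mu - lam).
Hypotheses (d0 : del != 0) (d1 : del - 1 != 0) (d2 : del - 2 != 0)
  (d12 : 2 * del - 1 != 0) (d32 : 2 * del - 3 != 0).

Definition Q0 : Map R := fun sg => opg (q0 lam del (of_gr sg)).

Lemma Q0E s : Q0 (to_gr s) = opg (q0 lam del s).
Proof. by rewrite /Q0 to_grK. Qed.

Lemma Q0_lin_gr k h s r a : Q0 (to_gr (Gadd (Gscale k s) (Gscale h r))) (emb a) =
  sadd (sscale k (Q0 (to_gr s) (emb a))) (sscale h (Q0 (to_gr r) (emb a))).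
Proof.
rewrite !Q0E.
rewrite q0_lin.
rewrite !opgE.
rewrite opgS_lin.
rewrite !embscale.
rewrite embadd.
by [].
Qed.

Lemma Q0_linear : linear_map Q0.
Proof.
move=> sg tg k h gs gt; rewrite -(of_grK gs) -(of_grK gt) to_gr_lin.
apply/opeqP => a. exact: Q0_lin_gr.
Qed.

Lemma below5 s : below 5 s.
Proof. by case: s => *; move=> [|[|[|[|[|K]]]]]. Qed.

Lemma Q0_bijective : bijective_map Q0.
Proof.
split; [|split].
- by move=> sg /of_grK <-; rewrite Q0E; apply: Dsum_opg (below5 _) => //; right.
- move=> sg tg gs gt. rewrite -(of_grK gs) -(of_grK gt).
  move: (of_gr sg) (of_gr tg) => s r. rewrite !Q0E. move=> /opg_inj.
  move=> /(congr1 (q0inv lam del)). rewrite !q0K. by move=> ->.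
- move=> B hB; have [s _ e] := Dsum_ex (isT : (4 < 5)%N) (or_intror erefl) hB.
  exists (to_gr (q0inv lam del s)); split; first exact: graded_to_gr.
  by rewrite Q0E q0invK; exact: opeq_sym.
Qed.

Lemma Q0_equivariant : equivariant lam mu Q0.
Proof.
move=> X sg sg' /of_grK <- h; have /of_grK e := h.1.
move: h; rewrite -e => /grrel_actG ->.
rewrite !Q0E -q0_equiv//.
exact: opeq_sym (Lop_opg _ _ _ _).
Qed.

Lemma lev_neq K K' s : K != K' -> lev K (lev K' s) = Gzero.
Proof.
by case: s => ? ? ? ? ? ? ? ? ?; case: K => [|[|[|[|[|K]]]]]; case: K' => [|[|[|[|[|K']]]]].
Qed.

Lemma Q0_symbol K f : (K < 5)%N -> sym K f ->
  Dle K (Q0 (grinj K f)) /\ Dlt K (opsub (Q0 (grinj K f)) (opsym K f)).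
Proof.
move=> K5 /(sym_lev K5) [s ->]; rewrite grinj_lev// Q0E.
have low := @q0_lev_below _ A lam del K s; split.
  apply: (Dsum_opg K5 (or_intror erefl)) => K' KK'.
  have := low _ (ltnW KK'); rewrite levD levZ => /Gsub_eq0 ->.
  by rewrite lev_neq// neq_ltn KK' orbT.
by apply: (Dlt_sub_below K5 _ (opsym_lev s K5)).2 low.
Qed.

Lemma Q0_diffexpr : diffexpr Q0.
Proof.
(* The power of dx is half of the weight left over by the target monomial and the odd
   derivatives. *)
move=> K K5; exists (fun m n l' m' n' => Tder (qc lam del K m n l' m' n')
  ((K - wt l' m' n' - (m (+) m') - (n (+) n'))./2)%N (m (+) m') (n (+) n')).
split.
  move=> m n l' m' n'; apply: isdiffop_T.
  (* Since K is below 5, the power of dx is at most 2, the range of [isdiffop_T]. *)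
  rewrite -[X in (_ <= X)%N]/(5./2)%N; apply: half_leq.
  by rewrite -!subnDA; apply: leq_trans (leq_subr _ _) (ltnW K5).
move=> f /(sym_lev K5) [s ->]; rewrite grinj_lev// Q0E; apply/opeqP => a.
rewrite opgE opgS_sum /bools.
case: K K5 => [|[|[|[|[|//]]]]] _.
all: rewrite ?q0_lev0 ?q0_lev1 ?q0_lev2 ?q0_lev3 ?q0_lev4; cbn [t0 p1 q1 t2 u2 p3 q3 t4 u4].
all: rewrite /sbig unlock /=.
all: rewrite ?emb_T ?embzero ?embadd ?emb_mono ?embmul ?embadd.
all: by rewrite !(Amul0, Aadd0, A0add) /monoS /= ?AaddA.
Qed.

Lemma Q0_quantization : quantization Q0.
Proof.
split; first exact: Q0_linear.
split; first exact: Q0_bijective.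
by split; [exact: Q0_diffexpr|exact: Q0_symbol].
Qed.

Lemma quantization_unique (Q : Map R) : quantization Q -> equivariant lam mu Q ->
  forall sg, graded sg -> opeq (Q sg) (Q0 sg).
Proof.
move=> [Qlin [[Qle _] [_ Qsym]]] Qequiv.
(* [b] is the inverse of [q0] applied to the coefficients of [Q]; the facts below are the hypotheses
   of [rigid]. *)
have [b Qb] : exists b : grs -> grs, forall s, opeq (Q (to_gr s)) (opg (q0 lam del (b s))).
  have Qex s : exists r, opeq (Q (to_gr s)) (opg (q0 lam del r)).
    have [r _ e] := Dsum_ex (isT : (4 < 5)%N) (or_intror erefl) (Qle _ (graded_to_gr s)).
    by exists (q0inv lam del r); rewrite q0invK.
  by exists (fun s => sval (cid (Qex s))) => s; exact: svalP (cid (Qex s)).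
have q0_inj s r : opeq (opg (q0 lam del s)) (opg (q0 lam del r)) -> s = r.
  by move=> /opg_inj /(congr1 (q0inv lam del)); rewrite !q0K.
have b_lin k h s r : b (Gadd (Gscale k s) (Gscale h r)) =
    Gadd (Gscale k (b s)) (Gscale h (b r)).
  apply: q0_inj; apply: opeq_trans (opeq_sym (Qb _)) _.
  rewrite -to_gr_lin; apply/opeqP => a.
  rewrite (Qlin _ _ k h (graded_to_gr s) (graded_to_gr r)); last exact: ssmooth_emb.
  rewrite !Qb; try exact: ssmooth_emb.
  by rewrite !opgE q0_lin opgS_lin !embscale embadd.
have b_act Y s : b (actG del Y s) = actG del Y (b s).
  apply: q0_inj; apply: opeq_trans (opeq_sym (Qb _)) _; rewrite -q0_equiv//.
  have e := (grrel_actG lam mu Y s (actG del Y s)).2 erefl.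
  apply: opeq_trans (Qequiv _ _ _ (graded_to_gr s) e) _.
  exact: opeq_trans (Lop_eq _ _ _ (Qb s)) (Lop_opg _ _ _ _).
have b_top K s : (K < 5)%N ->
    below K (Gadd (q0 lam del (b (lev K s))) (Gscale (-1) (lev K s))).
  move=> K5; have sK : sym K (to_gr s K) by have := graded_to_gr s K; rewrite K5.
  have [_] := Qsym K _ K5 sK; rewrite grinj_lev//.
  by move=> /(Dlt_sub_below K5 (Qb _) (opsym_lev s K5)).
move=> sg /of_grK <-; rewrite Q0E.
apply: opeq_trans (Qb _) _.
by rewrite (rigid d0 d1 d2 d12 d32 b_lin b_act b_top).
Qed.
End Quantization.
End Operators.

Theorem theorem1p1 (R : realType) (lam mu : R[i]) :
  mu - lam <> 0 -> mu - lam <> 1 / 2 -> mu - lam <> 1 ->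
  mu - lam <> 3 / 2 -> mu - lam <> 2 ->
  (exists Phi : Map R, osp_iso lam mu Phi) /\
  (exists Q : Map R, quantization Q /\ equivariant lam mu Q) /\
  (forall Q1 Q2 : Map R,
     quantization Q1 -> equivariant lam mu Q1 ->
     quantization Q2 -> equivariant lam mu Q2 ->
     forall sg, graded sg -> opeq (Q1 sg) (Q2 sg)).
Proof.
move=> /eqP d0 n12 /eqP; rewrite -subr_eq0 => d1 n32 /eqP; rewrite -subr_eq0 => d2.
have two0 : (2 : R[i]) != 0 by rewrite pnatr_eq0.
have d12 : 2 * (mu - lam) - 1 != 0.
  apply/eqP => e; apply: n12; apply: (mulfI two0).
  by rewrite mulrCA mulfV// mulr1; apply/eqP; rewrite -subr_eq0 e.
have d32 : 2 * (mu - lam) - 3 != 0.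
  apply/eqP => e; apply: n32; apply: (mulfI two0).
  by rewrite mulrCA mulfV// mulr1; apply/eqP; rewrite -subr_eq0 e.
have eqv := Q0_equivariant d0 d1 d2 d12 d32.
have qua := Q0_quantization lam mu.
(* The explicit quantization is itself the module isomorphism. *)
split; first by exists (Q0 lam mu); split; [case: qua|split; [case: qua => _ []|]].
split; first by exists (Q0 lam mu).
(* Both maps are compared with the explicit one. *)
move=> Q1 Q2 h1 e1 h2 e2 sg gs; apply: (@opeq_trans _ _ (Q0 lam mu sg)).
  exact: (quantization_unique d0 d1 d2 d12 d32 h1 e1).
by apply: opeq_sym; exact: (quantization_unique d0 d1 d2 d12 d32 h2 e2).
Qed.
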